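(* Let $K$ be an oriented $1$-knot in $S^3$, and let $(m,n)\in\mathbb{Z}\times\mathbb{N}$ be such that either $m\neq 0$ and $|m|$ and $n$ are coprime, or $(m,n)=(0,1)$. Let $K^{m,n}\subset S^4$ be the $(m,n)$-branched twist spin of $K$, let $N(K^{m,n})$ be a compact tubular neighborhood of $K^{m,n}$ in $S^4$, and let $\Delta_K(t)$ be the Alexander polynomial of $K$. Then the number of conjugacy classes (under conjugation in $SL(2,\mathbb{C})$) of irreducible $SL(2,\mathbb{C})$-metabelian representations of $\pi_1(S^4\setminus \mathrm{int}\,N(K^{m,n}))$ is $$ \begin{cases} \dfrac{|\Delta_K(-1)|-1}{2} & \text{if } m \text{ is even},\\[2mm] 0 & \text{if } m \text{ is odd}. \end{cases} $$
   Context: **Metabelian representations.** An $SL(2,\mathbb{C})$-metabelian representation of a group $\Gamma$ is a homomorphism $\rho:\Gamma\to SL(2,\mathbb{C})$ such that $\rho([\Gamma,\Gamma])$ is abelian. It is irreducible if no line in $\mathbb{C}^2$ is invariant under $\rho(\Gamma)$. **Branched twist spins.** A $2$-knot is a smoothly embedded $2$-sphere in $S^4$. Let $m\neq 0$, $n\geq 1$, with $|m|$ and $n$ coprime, and let $K$ be an oriented knot in $S^3$. Consider an effective locally smooth $S^1$-action on $S^4$ with orbit space $S^3$, orbit map $p$, and orbit data $\{(S^3,K),|m|,n\}$ (by Montgomery–Yang, Fintushel and Pao, the action is determined by its orbit data up to weak equivalence). This means the following. The fixed point set $F$ is two points. The knot $K$ is the union of the two points $F^*=p(F)$ and two open arcs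 $E_m^*$ and $E_n^*$ joining them. The set $E_m=p^{-1}(E_m^* )$ consists of orbits with isotropy group $\mathbb{Z}_{|m|}$, and $E_n=p^{-1}(E_n^* )$ consists of orbits with isotropy group $\mathbb{Z}_n$ (these are free orbits if the corresponding integer is $1$). All other orbits are free. The set $E_n\cup F$ is a smoothly embedded $2$-sphere. The sign of $m$ is taken into account as follows. Orient $S^4$, and orient the orbits by the $S^1$-action. Let $V_m$ (resp. $V_n$) be the solid torus that is the preimage of a small disk in $S^3$ transversal to $E_m^*$ (resp. $E_n^*$), the core of $V_m$ (resp. $V_n$) being an orbit in $E_m$ (resp. $E_n$). Orient $V_m$ so that $V_m\times E_m^*$ has the orientation of $S^4$, where $E_m^*$ is oriented as part of $K$. Choose a meridian–longitude pair $(\Theta,H)$ of $V_m\cong D^2\times S^1$ such that $H$ is the meridian of $V_n$ in the decomposition $V_m\cup V_n=p^{-1}(\partial D^{3*})$, where $D^{3*}$ is a small ball neighborhood of a point of $F^*$. The orbits are required to be in the direction $\varepsilon n\Theta+|m|H$, where $\varepsilon=1$ if $m\geq 0$ and $\varepsilon=-1$ if $m<0$. With this convention, the $(m,n)$-branched twist spin of $K$ is the $2$-knot $K^{m,n}=E_n\cup F$. In addition, $K^{0,1}$ is defined to be the spun knot of $K$. (The knot $K^{m,1}$ is the $m$-twist spun knot of $K$.) **Known description of the knot group.** If $\langle y_1,\dots,y_s\mid r_1,\dots,r_t\rangle$ is a presentation of the knot group of $K$ such that $y_1$ is a meridian, then $$\pi_1(S^4\setminus\mathrm{int}\,N(K^{m,n}))\cong\langle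 y_1,\dots,y_s,h\mid r_1,\dots,r_t,\ y_ihy_i^{-1}h^{-1}\ (1\le i\le s),\ y_1^{|m|}h^{\beta}\rangle,$$ where $\beta$ is an integer with $n\beta\equiv\varepsilon \pmod m$ if $m\neq 0$, and $\beta=1$ if $m=0$. *)

(* Defs.v *)
From HB Require Import structures.
From mathcomp Require Import all_boot all_order all_algebra.
From mathcomp Require Import complex.
From mathcomp Require Import all_classical all_reals all_analysis.

Set Implicit Arguments.
Unset Strict Implicit.
Unset Printing Implicit Defensive.

Import Order.TTheory GRing.Theory Num.Theory.
Import numFieldNormedType.Exports.

Local Open Scope classical_set_scope.
Local Open Scope ring_scope.

Section Spheres.
Variable R : realType.

Definition sqnorm (k : nat) (x : 'rV[R]_k) : R := \sum_(i < k) x 0 i ^+ 2.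

Definition dotp (k : nat) (x y : 'rV[R]_k) : R := \sum_(i < k) x 0 i * y 0 i.

Definition sphere (k : nat) : set 'rV[R]_k.+1 := [set x | sqnorm x = 1].

Definition cball (k : nat) (r : R) : set 'rV[R]_k := [set x | sqnorm x <= r ^+ 2].

Definition oball (k : nat) (r : R) : set 'rV[R]_k := [set x | sqnorm x < r ^+ 2].

(* The circle as R/Z: angle t in R has period 1. *)
Definition circle_pt (t : R) : 'rV[R]_2 :=
  \row_(i < 2) (if i == 0 then cos (2 * pi * t) else sin (2 * pi * t)).

End Spheres.

Arguments sphere R k : clear implicits.
Arguments cball {R} k r.
Arguments oball {R} k r.

Section Smoothness.
Variable R : realType.

(* C^infinity: all iterated directional derivatives exist and are continuous. *)
Definition smooth_on (V W : normedModType R) (U : set V) (f : V -> W) : Prop :=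
  forall (vs : seq V) (x : V), U x ->
    let g := foldr (fun v (g0 : V -> W) => 'D_v g0) f vs in
    {for x, continuous g} /\ (forall v, derivable g x v).

(* f restricts to a smooth embedding of S^k in S^n. *)
Definition smooth_embedding (k n : nat) (f : 'rV[R]_k.+1 -> 'rV[R]_n.+1) : Prop :=
  [/\ exists U, [/\ open U, sphere R k `<=` U & smooth_on U f],
      forall x, sphere R k x -> sphere R n (f x),
      {in sphere R k &, injective f}
    & forall x v, sphere R k x -> dotp x v = 0 -> v != 0 -> 'D_v f x != 0].

(* e restricts to a smooth embedding of S^k x D^2 in S^n carrying S^k x {0}
   onto C.  For n = k + 2 its image is a compact tubular neighborhood of C;
   no twisted disk bundle is needed, since the normal bundle of a circle in S^3
   or of a 2-sphere in S^4 is trivial. *)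
Definition tubular_embedding (k n : nat) (C : set 'rV[R]_n.+1)
    (e : 'rV[R]_k.+1 * 'rV[R]_2 -> 'rV[R]_n.+1) : Prop :=
  let D := sphere R k `*` cball 2 1 in
  [/\ exists U, [/\ open U, D `<=` U & smooth_on U e],
      forall z, D z -> sphere R n (e z),
      {in D &, injective e},
      forall z v, D z -> dotp z.1 v.1 = 0 -> v != 0 -> 'D_v e z != 0
    & [set e (x, 0) | x in sphere R k] = C].

Definition tubular_neighborhood (B N : set 'rV[R]_5) : Prop :=
  exists2 e : 'rV[R]_3 * 'rV[R]_2 -> 'rV[R]_5,
    tubular_embedding B e & N = e @` (sphere R 2 `*` cball 2 1).

(* The interior of N is taken in S^4, not in R^5. *)
Definition exterior (N : set 'rV[R]_5) : set 'rV[R]_5 :=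
  sphere R 4 `\` [set x | \forall y \near x, sphere R 4 y -> N y].

(* An oriented knot is a parametrization of its image by the circle. *)
Definition knot (K : 'rV[R]_2 -> 'rV[R]_4) : Prop := smooth_embedding K.

Definition two_knot (B : set 'rV[R]_5) : Prop :=
  exists2 f : 'rV[R]_3 -> 'rV[R]_5, smooth_embedding f & f @` sphere R 2 = B.

Definition knot_image (K : 'rV[R]_2 -> 'rV[R]_4) : set 'rV[R]_4 :=
  K @` sphere R 1.

Definition knot_complement (K : 'rV[R]_2 -> 'rV[R]_4) : set 'rV[R]_4 :=
  sphere R 3 `\` knot_image K.

End Smoothness.

Section FundamentalGroup.
Variables (R : realType) (T : topologicalType).
Implicit Types (X : set T) (f g : R -> T).

Definition loop_in X (x0 : T) f : Prop :=
  [/\ {within `[0, 1], continuous f}, (forall t, t \in `[0, 1] -> X (f t)),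
      f 0 = x0 & f 1 = x0].

Definition free_homotopic X f g : Prop :=
  exists H : R * R -> T,
    [/\ {within `[0, 1] `*` `[0, 1], continuous H},
        forall s t, s \in `[0, 1] -> t \in `[0, 1] -> X (H (s, t)),
        forall t, t \in `[0, 1] -> H (0, t) = f t /\ H (1, t) = g t
      & forall s, s \in `[0, 1] -> H (s, 0) = H (s, 1)].

Definition based_homotopic X (x0 : T) f g : Prop :=
  exists H : R * R -> T,
    [/\ {within `[0, 1] `*` `[0, 1], continuous H},
        forall s t, s \in `[0, 1] -> t \in `[0, 1] -> X (H (s, t)),
        forall t, t \in `[0, 1] -> H (0, t) = f t /\ H (1, t) = g t
      & forall s, s \in `[0, 1] -> H (s, 0) = x0 /\ H (s, 1) = x0].

Definition path_concat f g : R -> T :=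
  fun t => if t <= 2^-1 then f (2 * t) else g (2 * t - 1).

(* cls exhibits G as the group of based homotopy classes of loops, pi_1(X, x0). *)
Definition is_pi1 X (x0 : T) (G : groupType) (cls : (R -> T) -> G) : Prop :=
  [/\ X x0,
      forall a, exists2 f, loop_in X x0 f & cls f = a,
      forall f g, loop_in X x0 f -> loop_in X x0 g ->
        (cls f = cls g <-> based_homotopic X x0 f g)
    & forall f g, loop_in X x0 f -> loop_in X x0 g ->
        cls (path_concat f g) = (cls f * cls g)%g].

End FundamentalGroup.

(* A meridian, without choice of sense: the class of a based loop freely
   homotopic in the complement to the boundary of a fibre disk of a tubular
   neighborhood of K. *)
Definition is_meridian (R : realType) (K : 'rV[R]_2 -> 'rV[R]_4) (x0 : 'rV[R]_4)
    (G : groupType) (cls : (R -> 'rV[R]_4) -> G) (a : G) : Prop :=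
  exists (e : 'rV[R]_2 * 'rV[R]_2 -> 'rV[R]_4) (x : 'rV[R]_2) (f : R -> 'rV[R]_4),
    [/\ tubular_embedding (knot_image K) e, sphere R 1 x,
        loop_in (knot_complement K) x0 f, cls f = a
      & free_homotopic (knot_complement K) f (fun t => e (x, circle_pt t))].

Section Presentations.

(* (i, true) stands for the generator i and (i, false) for its inverse. *)
Definition word (I : Type) := seq (I * bool).

Fixpoint word_eval (G : groupType) (I : Type) (y : I -> G) (w : word I) : G :=
  if w is (i, b) :: w' then ((if b then y i else (y i)^-1) * word_eval y w')%g
  else 1%g.

(* Equality in the group presented by the relators rels. *)
Inductive word_eq (I : eqType) (rels : seq (word I)) : word I -> word I -> Prop :=
| WordRefl u : word_eq rels u u
| WordSym u v : word_eq rels u v -> word_eq rels v u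
| WordTrans u v w : word_eq rels u v -> word_eq rels v w -> word_eq rels u w
| WordCat u v u' v' : word_eq rels u v -> word_eq rels u' v' ->
    word_eq rels (u ++ u') (v ++ v')
| WordCancel i b : word_eq rels [:: (i, b); (i, ~~ b)] [::]
| WordRel r : r \in rels -> word_eq rels r [::].

(* G = < y | rels >. *)
Definition presents (G : groupType) (I : eqType) (y : I -> G)
    (rels : seq (word I)) : Prop :=
  (forall a, exists w, word_eval y w = a) /\
  (forall u v, word_eval y u = word_eval y v <-> word_eq rels u v).

Definition word_map (I J : Type) (h : I -> J) (w : word I) : word J :=
  [seq (h l.1, l.2) | l <- w].

Definition word_exp (I : Type) (i : I) (z : int) : word I :=
  nseq `|z|%N (i, 0 <= z).

(* Relators of < y_1, .., y_s, h | r_1, .., r_t, y_i h y_i^-1 h^-1,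
   y_1^|m| h^beta >; the generator y_{i+1} is Some i and h is None. *)
Definition twist_relators (s : nat) (rels : seq (word 'I_s.+1)) (m beta : int) :
    seq (word (option 'I_s.+1)) :=
  map (word_map Some) rels
  ++ [seq [:: (Some i, true); (None, true); (Some i, false); (None, false)]
     | i <- enum 'I_s.+1]
  ++ [:: word_exp (Some ord0) `|m| ++ word_exp None beta].

Definition twist_exponent (m : int) (n : nat) (beta : int) : Prop :=
  if m == 0 then beta = 1
  else (n%:Z * beta = (if 0 <= m then 1 else -1) %[mod m])%Z.

End Presentations.

Inductive derived_subgroup (G : groupType) : G -> Prop :=
| DerCommutator a b : derived_subgroup (a^-1 * (b^-1 * (a * b)))%g
| DerOne : derived_subgroup 1%g
| DerMul a b : derived_subgroup a -> derived_subgroup b -> derived_subgroup (a * b)%g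
| DerInv a : derived_subgroup a -> derived_subgroup (a^-1)%g.

Section AlexanderPolynomial.

(* Z[t, 1/t] is embedded in the fraction field of Z[t]. *)
Definition tvar : {fraction {poly int}} := tofrac 'X.

(* Image of the Fox derivative of w with respect to the generator i under the
   ring morphism sending the generator j to t ^ deg j, from
   d(xw) = dx + x dw and d(x^-1) = - x^-1 dx. *)
Fixpoint fox (I : eqType) (deg : I -> int) (i : I) (w : word I) :
    {fraction {poly int}} :=
  if w is (j, b) :: w' then
    (if b then (j == i)%:R else - (tvar ^ (- deg j)) * (j == i)%:R)
    + tvar ^ (if b then deg j else - deg j) * fox deg i w'
  else 0.

(* ab is the abelianization G -> Z. *)
Definition infinite_cyclic_abelianization (G : groupType) (ab : G -> int) : Prop :=
  [/\ forall a b, ab (a * b)%g = ab a + ab b,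
      forall z, exists a, ab a = z
    & forall a, ab a = 0 <-> derived_subgroup a].

(* Delta is computed by Fox calculus from a deficiency one presentation of the
   knot group whose first generator is a meridian, by deleting the column of
   that generator.  It is only defined up to units +- t^k of Z[t, 1/t]; Delta
   is any representative lying in Z[t]. *)
Definition alexander_polynomial (R : realType) (K : 'rV[R]_2 -> 'rV[R]_4)
    (Delta : {poly int}) : Prop :=
  exists (x0 : 'rV[R]_4) (G : groupType) (cls : (R -> 'rV[R]_4) -> G)
         (s : nat) (y : 'I_s.+1 -> G) (rels : s.-tuple (word 'I_s.+1))
         (ab : G -> int) (sgn : bool) (k : int),
    [/\ is_pi1 (knot_complement K) x0 cls,
        presents y rels,
        is_meridian K x0 cls (y ord0),
        infinite_cyclic_abelianization ab /\ ab (y ord0) = 1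
      & tofrac Delta = (-1) ^+ sgn * tvar ^ k *
          \det (\matrix_(j < s, i < s)
                  fox (fun l => ab (y l)) (lift ord0 i) (tnth rels j))].

End AlexanderPolynomial.

Section CircleActions.
Variable R : realType.
Implicit Types (act : R -> 'rV[R]_5 -> 'rV[R]_5) (K : 'rV[R]_2 -> 'rV[R]_4).

(* A continuous action of the circle R/Z on S^4. *)
Definition circle_action act : Prop :=
  [/\ {within setT `*` sphere R 4,
        continuous (fun z : R * 'rV[R]_5 => act z.1 z.2)},
      forall t x, sphere R 4 x -> sphere R 4 (act t x),
      forall s t x, sphere R 4 x -> act (s + t) x = act s (act t x),
      forall x, sphere R 4 x -> act 0 x = x
    & forall x, sphere R 4 x -> act 1 x = x].

Definition effective act : Prop :=
  forall t, (forall x, sphere R 4 x -> act t x = x) -> exists z : int, t = z%:~R.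

Definition isotropy act (x : 'rV[R]_5) : set R := [set t | act t x = x].

(* The subgroup of order k of R/Z. *)
Definition cyclic_angles (k : nat) : set R := [set t | exists z : int, t * k%:R = z%:~R].

(* A linear tube about the orbit of x (Bredon): sigma is an orthogonal
   representation of the isotropy group G_x, phi is an equivariant slice at x,
   and (t, v) |-> t . phi v induces an open embedding of the twisted product of
   the circle with the slice over G_x. *)
Definition linear_tube act (x : 'rV[R]_5) : Prop :=
  exists (d : nat) (sigma : R -> 'M[R]_d) (phi : 'rV[R]_d -> 'rV[R]_5),
    let Gx := isotropy act x in
    ([/\ {within Gx, continuous sigma},
        forall s t, Gx s -> Gx t -> sigma (s + t) = sigma s *m sigma t
      & forall t, Gx t -> sigma t *m (sigma t)^T = 1%:M] /\
    [/\ continuous phi, phi 0 = x, forall v, sphere R 4 (phi v)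
      & forall t v, Gx t -> act t (phi v) = phi (v *m sigma t)]) /\
    ((forall s t v w, act s (phi v) = act t (phi w) ->
       Gx (s - t) /\ w = v *m sigma (s - t)) /\
    (forall W : set (R * 'rV[R]_d), open W ->
       exists2 O : set 'rV[R]_5, open O &
         [set act z.1 (phi z.2) | z in W] = sphere R 4 `&` O)).

Definition locally_smooth act : Prop := forall x, sphere R 4 x -> linear_tube act x.

(* p identifies the orbit space with S^3. *)
Definition orbit_map act (p : 'rV[R]_5 -> 'rV[R]_4) : Prop :=
  [/\ {within sphere R 4, continuous p},
      p @` sphere R 4 = sphere R 3
    & forall x y, sphere R 4 x -> sphere R 4 y ->
        (p x = p y <-> exists t, y = act t x)].

(* The action has orbit data {(S^3, K), k, n}, with fixed points a and b; the
   arcs E_k^* and E_n^* of K are traced by the angles in ]t0, t1[ and in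
   ]t1, t0 + 1[. *)
Definition orbit_data act p K (k n : nat) (a b : 'rV[R]_5) (t0 t1 : R) : Prop :=
  let arc (u v : R) := [set K (circle_pt t) | t in `]u, v[] in
  [/\ [/\ sphere R 4 a, sphere R 4 b, a <> b
       & forall x, sphere R 4 x ->
           ((forall t, act t x = x) <-> x = a \/ x = b)],
      [/\ t0 < t1, t1 < t0 + 1, p a = K (circle_pt t0) & p b = K (circle_pt t1)],
      forall x, sphere R 4 x -> arc t0 t1 (p x) -> isotropy act x = cyclic_angles k,
      forall x, sphere R 4 x -> arc t1 (t0 + 1) (p x) ->
        isotropy act x = cyclic_angles n
    & forall x, sphere R 4 x -> ~ knot_image K (p x) ->
        isotropy act x = cyclic_angles 1].

(* B = E_n u F for some action with orbit data {(S^3, K), |m|, n}.  Such an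
   action gives the (m, n)-branched twist spin for one of the two orientations
   of S^4 and the (-m, n)-branched twist spin for the other; orientations of S^4
   being immaterial to B as a subset, the predicate admits both. *)
Definition twisted_spin K (m : int) (n : nat) (B : set 'rV[R]_5) : Prop :=
  exists act p a b t0 t1,
    [/\ [/\ circle_action act, effective act & locally_smooth act],
        orbit_map act p,
        orbit_data act p K `|m|%N n a b t0 t1,
        B = [set x | sphere R 4 x /\
              [set K (circle_pt t) | t in `]t1, t0 + 1[] (p x)] `|` [set a; b]
      & two_knot B].

(* Artin spinning: iota embeds the 3-ball in S^3 as the complement of an open
   ball jota(int B^3) meeting K in an unknotted arc, so that iota^-1(K) is a
   knotted arc of the 3-ball; the 3-ball is the orbit space of the rotation of
   the last two coordinates of S^4, and B is the preimage of the arc.  That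
   jota is defined on the ball of radius 2 provides a collar. *)
Definition spun_knot K (B : set 'rV[R]_5) : Prop :=
  exists iota jota : 'rV[R]_3 -> 'rV[R]_4,
    [/\ {within cball 3 1, continuous iota} /\ {in cball 3 1 &, injective iota},
        [/\ {within cball 3 2, continuous jota}, {in cball 3 2 &, injective jota},
            jota @` cball 3 2 `<=` sphere R 3
          & forall v, cball 3 2 v ->
              (knot_image K (jota v) <-> forall i, i != 0 -> v 0 i = 0)],
        iota @` cball 3 1 = sphere R 3 `\` jota @` oball 3 1,
        B = [set x | sphere R 4 x /\ knot_image K (iota (lsubmx (x : 'rV[R]_(3 + 2))))]
      & two_knot B].

Definition branched_twist_spin K (m : int) (n : nat) (B : set 'rV[R]_5) : Prop :=
  if m == 0 then spun_knot K B else twisted_spin K m n B.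

End CircleActions.

(* The known description of the group G of the (m, n)-branched twist spin of K,
   in terms of an arbitrary presentation of the knot group of K whose first
   generator is a meridian. *)
Definition known_group_description (R : realType) (K : 'rV[R]_2 -> 'rV[R]_4)
    (m : int) (n : nat) (G : groupType) : Prop :=
  forall (x0 : 'rV[R]_4) (GK : groupType) (cls : (R -> 'rV[R]_4) -> GK)
         (s : nat) (y : 'I_s.+1 -> GK) (rels : seq (word 'I_s.+1)) (beta : int),
    is_pi1 (knot_complement K) x0 cls ->
    presents y rels -> is_meridian K x0 cls (y ord0) ->
    twist_exponent m n beta ->
    exists z : option 'I_s.+1 -> G, presents z (twist_relators rels m beta).

Section Representations.
Variables (R : realType) (G : groupType).
Implicit Types rho : G -> 'M[R[i]]_2.

Definition SL2_representation rho : Prop :=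
  (forall a, \det (rho a) = 1) /\ (forall a b, rho (a * b)%g = rho a *m rho b).

Definition metabelian rho : Prop :=
  forall a b, derived_subgroup a -> derived_subgroup b ->
    rho a *m rho b = rho b *m rho a.

Definition irreducible rho : Prop :=
  ~ exists2 v : 'cV[R[i]]_2, v != 0 & forall a, exists c, rho a *m v = c *: v.

Definition SL2_conjugate rho rho' : Prop :=
  exists2 P : 'M[R[i]]_2, \det P = 1 & forall a, rho' a = P *m rho a *m invmx P.

Definition irreducible_metabelian_classes : set (set (G -> 'M[R[i]]_2)) :=
  [set C | exists2 rho, [/\ SL2_representation rho, metabelian rho & irreducible rho]
                      & C = [set rho' | SL2_conjugate rho rho']].

End Representations.

(* Main.v *)
(* Let D(x) = diag(x, 1/x) and J = [[0, 1], [-1, 0]].  An irreducible metabelian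
   representation rho of the 2-knot group G sends the central generator h to a
   scalar, and rho(G') preserves exactly two lines, which the meridian y_0
   exchanges; so rho is conjugate to a representation with y_0 |-> J and
   rho(G') diagonal.  Every generator y_i of degree d_i is y_0^{d_i} up to an
   element of G', hence y_i |-> D(u_i) J^{d_i}, and since J D(x) = D(1/x) J the
   knot relators say exactly that u^F = 1, where F is the Fox matrix at t = -1
   (with the column of y_0 deleted).  The relator y_0^|m| h^beta forces J^|m| to
   be scalar, i.e. m even, and then beta is odd and the image of h is determined.
   The Smith normal form of F shows that u^F = 1 has |det F| = |Delta(-1)|
   solutions.  Conjugation identifies u with 1/u only, u = 1 is the only solution
   with u = 1/u, and it is the only one whose representation is reducible. *)

Require Import Defs.
From HB Require Import structures.
From mathcomp Require Import all_boot all_order all_algebra all_field.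
From mathcomp Require Import complex ring zify.
From mathcomp Require Import all_classical all_reals all_analysis.

Set Implicit Arguments.
Unset Strict Implicit.
Unset Printing Implicit Defensive.

Import Order.TTheory GRing.Theory Num.Theory.
Import numFieldNormedType.Exports.
Local Open Scope classical_set_scope.
Local Open Scope ring_scope.

(** * Counting the solutions of u^F = 1 *)

Section TorusKernel.
Variable C : numClosedFieldType.

(** [X^|d| - 1] is separable in characteristic 0, so it has [|d|] distinct roots; a negative [d]
    leads to the same equation after inverting [x]. *)
Lemma roots_of_unity_seq (d : int) : d != 0 ->
  exists r : seq C, [/\ uniq r, size r = `|d|%N
    & forall x, (x \in r) = (x != 0) && (x ^ d == 1)].
Proof.
move=> d0; have n_gt0 : (0 < `|d|)%N by rewrite absz_gt0.
have [r def_r] := closed_field_poly_normal ('X^`|d|%N - 1 : {poly C}).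
move: def_r; rewrite lead_coefXnsubC // scale1r.
move=> def_r; exists r; split.
- by rewrite -separable_prod_XsubC -def_r separable_Xn_sub_1 // pnatr_eq0 -lt0n.
- have := size_prod_XsubC r id; rewrite -def_r size_XnsubC //; by case.
- move=> x; rewrite -root_prod_XsubC -def_r /root !hornerE subr_eq0.
  have [->|x0] /= := eqVneq x 0; first by rewrite expr0n eqn0Ngt n_gt0 eq_sym oner_eq0.
  case: d {d0 n_gt0 def_r} => n; first by [].
  by rewrite NegzE -exprz_inv -[_ ^ n.+1]/(_ ^+ _) exprVn invr_eq1.
Qed.

Lemma ffun_prod_seq (s : nat) (L : 'I_s -> seq C) :
  (forall i, uniq (L i)) ->
  exists S : seq {ffun 'I_s -> C}, [/\ uniq S, size S = (\prod_i size (L i))%N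
    & forall u : {ffun 'I_s -> C}, (u \in S) = [forall i, u i \in L i]].
Proof.
(* [C] is not finite, so the families are formed over the finite type of all values occurring in the
   lists. *)
move=> uL; pose T := seq_sub (flatten [seq L i | i <- enum 'I_s]).
have inT i x : x \in L i -> x \in flatten [seq L i | i <- enum 'I_s].
  by move=> xL; apply/flatten_mapP; exists i; rewrite ?mem_enum.
pose F i : pred T := [pred x | val x \in L i].
pose h (g : {ffun 'I_s -> T}) : {ffun 'I_s -> C} := [ffun i => val (g i)].
have h_inj : injective h.
  by move=> g g' /ffunP e; apply/ffunP => i; have := e i; rewrite !ffunE => /val_inj.
exists [seq h g | g <- enum (family F)]; split.
- by rewrite map_inj_uniq ?enum_uniq.
- rewrite size_map -cardE card_family foldrE big_map big_enum /=.
  apply: eq_bigr => i _; rewrite cardE -(size_map val); apply: perm_size.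
  apply: uniq_perm; rewrite ?(map_inj_uniq val_inj) ?enum_uniq // => x.
  apply/mapP/idP => [[y + ->] | xL]; first by rewrite mem_enum.
  by exists (SeqSub (inT i x xL)); rewrite ?mem_enum.
- move=> u; apply/mapP/forallP => [[g + ->] i | uL'].
    by rewrite mem_enum ffunE => /familyP/(_ i).
  exists [ffun i => SeqSub (inT i (u i) (uL' i))].
    by rewrite mem_enum; apply/familyP => i; rewrite ffunE inE uL'.
  by apply/ffunP => i; rewrite !ffunE.
Qed.

(* The monomial map u |-> u^F of algebraic tori. *)
Definition mulact (p q : nat) (F : 'M[int]_(p, q)) (u : {ffun 'I_q -> C}) :
  {ffun 'I_p -> C} := [ffun j => \prod_i u i ^ F j i].

Definition ffun_unit (q : nat) (u : {ffun 'I_q -> C}) := [forall i, u i != 0].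

Lemma expfz_prod (I : Type) (r : seq I) (F : I -> C) (n : int) :
  (\prod_(i <- r) F i) ^ n = \prod_(i <- r) F i ^ n.
Proof. exact: (big_morph _ (fun x y => expfzMl x y n) (exp1rz _ n)). Qed.

Lemma expfz_sum (I : Type) (r : seq I) (F : I -> int) (x : C) : x != 0 ->
  x ^ (\sum_(i <- r) F i) = \prod_(i <- r) x ^ F i.
Proof. by move=> x0; exact: (big_morph _ (fun m n => expfzDr m n x0) (expr0z x)). Qed.

Lemma mulact_unit (p q : nat) (F : 'M[int]_(p, q)) u :
  ffun_unit u -> ffun_unit (mulact F u).
Proof.
move=> /forallP u0; apply/forallP => j; rewrite ffunE.
by apply/prodf_neq0 => i _; rewrite expfz_neq0.
Qed.

(** Matrix entries may be negative, and adding such exponents requires nonzero bases; hence the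
    restriction to the torus. *)
Lemma mulactM (p q r : nat) (E : 'M[int]_(p, q)) (F : 'M[int]_(q, r)) u :
  ffun_unit u -> mulact (E *m F) u = mulact E (mulact F u).
Proof.
move=> /forallP u0; apply/ffunP => k; rewrite !ffunE.
under [RHS]eq_bigr => j _ do rewrite ffunE expfz_prod.
rewrite exchange_big; apply: eq_bigr => i _ /=.
rewrite mxE expfz_sum //; apply: eq_bigr => j _.
by rewrite exprz_exp mulrC.
Qed.

Lemma mulact_diag (q : nat) (d : 'I_q -> int) u :
  mulact (\matrix_(i, j) (d i *+ (i == j))) u = [ffun i => u i ^ d i].
Proof.
apply/ffunP => i; rewrite !ffunE (bigD1 i) //= mxE eqxx big1 ?mulr1 // => j ji.
by rewrite mxE eq_sym (negPf ji).
Qed.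

Lemma mulact1 (q : nat) u : mulact (1%:M : 'M[int]_q) u = u.
Proof.
apply/ffunP => i; rewrite !ffunE (bigD1 i) //= mxE eqxx big1 ?mulr1 // => j ji.
by rewrite mxE eq_sym (negPf ji).
Qed.

Lemma mulact_one (p q : nat) (F : 'M[int]_(p, q)) : mulact F [ffun=> 1] = [ffun=> 1].
Proof. by apply/ffunP => i; rewrite !ffunE big1 // => j _; rewrite ffunE exp1rz. Qed.

Definition torus_kernel (q : nat) (F : 'M[int]_q) (u : {ffun 'I_q -> C}) :=
  ffun_unit u && (mulact F u == [ffun=> 1]).

(** In a Smith form [F = A D B] the unimodular [A] and [B] act as automorphisms of the torus, so
    [u |-> u^B] identifies the kernel of [F] with that of [D], a product of groups of [d_i]-th roots
    of unity; and [det F] is the product of the [d_i] up to sign. *)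
Lemma torus_kernel_seq (q : nat) (F : 'M[int]_q) : \det F != 0 ->
  exists S : seq {ffun 'I_q -> C}, [/\ uniq S, size S = `|\det F|%N
    & forall u, (u \in S) = torus_kernel F u].
Proof.
have [A Au [B Bu [d _ ->]]] := int_Smith_normal_form F.
set D := \matrix_(i, j) _; rewrite !det_mulmx => detF0.
have absU (M : 'M[int]_q) : M \in unitmx -> `|\det M|%N = 1%N.
  by rewrite unitmxE => /orP[] /eqP->.
have defD : D = \matrix_(i, j) ((fun i : 'I_q => d`_i) i *+ (i == j)).
  by apply/matrixP => i j; rewrite !mxE.
have detD : \det D = \prod_(i < q) d`_i.
  rewrite det_trig => [|]; first by apply: eq_bigr => i _; rewrite mxE eqxx.
  by apply/is_trig_mxP => i j ij; rewrite mxE (ltn_eqF ij).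
have d0 (i : 'I_q) : d`_i != 0.
  apply: contraNneq detF0 => di0.
  by rewrite detD (bigD1 i) //= di0 mul0r mulr0 mul0r.
have [r rP] := fin_all_exists (fun i => roots_of_unity_seq (d0 i)).
have [S [uS szS memS]] := ffun_prod_seq (fun i => let: And3 h _ _ := rP i in h).
have SE u : (u \in S) = ffun_unit u && (mulact D u == [ffun=> 1]).
  rewrite memS defD mulact_diag; apply/forallP/andP => [uP | [/forallP u0 /eqP/ffunP uD] i].
    split; first by apply/forallP => i; have [_ _ rE] := rP i; have := uP i; rewrite rE => /andP[].
    apply/eqP/ffunP => i; rewrite !ffunE; apply/eqP.
    by have [_ _ rE] := rP i; have := uP i; rewrite rE => /andP[].
  by have [_ _ ->] := rP i; rewrite u0; have := uD i; rewrite !ffunE => ->; rewrite eqxx.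
exists [seq mulact (invmx B) v | v <- S]; split.
- rewrite map_inj_in_uniq // => v w; rewrite !SE => /andP[v0 _] /andP[w0 _].
  by move=> /(congr1 (mulact B)); rewrite -!mulactM // mulmxV // !mulact1.
- rewrite size_map szS !abszM (absU A) // (absU B) // mul1n muln1 detD.
  by rewrite (big_morph _ abszM absz1); apply: eq_bigr => i _; have [_ ->] := rP i.
- move=> u; apply/mapP/andP => [[v + ->] | [u0 /eqP uF]].
    rewrite SE => /andP[v0 /eqP vD]; split; first exact: mulact_unit.
    by rewrite -mulactM // mulmxK // mulactM // vD mulact_one.
  exists (mulact B u); last by rewrite -mulactM // mulVmx // mulact1.
  rewrite SE mulact_unit //= -mulactM //; apply/eqP.
  (* Writing [D B] as [A^-1 (A D B)] reduces the equation for [D] to the one for [F]. *)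
  rewrite -[D *m B](mulKmx Au) mulactM // mulmxA uF.
  exact: mulact_one.
Qed.

Lemma torus_kernel_one (q : nat) (F : 'M[int]_q) : torus_kernel F [ffun=> 1].
Proof.
rewrite /torus_kernel mulact_one eqxx andbT.
by apply/forallP => i; rewrite ffunE oner_eq0.
Qed.

Definition ffun_inv (q : nat) (u : {ffun 'I_q -> C}) : {ffun 'I_q -> C} :=
  [ffun i => (u i)^-1].

Lemma ffun_invK q : involutive (@ffun_inv q).
Proof. by move=> u; apply/ffunP => i; rewrite !ffunE invrK. Qed.

Lemma torus_kernel_inv (q : nat) (F : 'M[int]_q) u :
  torus_kernel F u -> torus_kernel F (ffun_inv u).
Proof.
move=> /andP[/forallP u0 /eqP/ffunP uF]; apply/andP; split.
  by apply/forallP => i; rewrite ffunE invr_eq0.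
apply/eqP/ffunP => j; have := uF j; rewrite !ffunE => uFj.
transitivity ((\prod_i u i ^ F j i)^-1); last by rewrite uFj invr1.
by rewrite -prodfV; apply: eq_bigr => i _; rewrite ffunE exprz_inv invr_expz.
Qed.
End TorusKernel.

(** Induction on the size: the head [x] and its partner [f x] leave the list together, and [x]
    represents the pair in [H]. *)
Lemma involution_half (T : eqType) (f : T -> T) (S : seq T) :
    uniq S -> involutive f -> (forall x, x \in S -> f x \in S) ->
    (forall x, x \in S -> f x != x) ->
  exists H : seq T, [/\ uniq H, (size H).*2 = size S, {subset H <= S},
    forall x, x \in S -> x \in H \/ f x \in H
    & forall x, x \in H -> f x \notin H].
Proof.
move=> + fK; have [n] := ubnP (size S); elim: n S => // n IH [|x S] leS uS Sf fN0.
  by exists [::]; split.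
have fxS : f x \in S.
  by have := Sf x (mem_head _ _); rewrite inE (negPf (fN0 _ (mem_head _ _))).
have [xS {}uS] := andP uS.
have remE y : (y \in rem (f x) S) = (y != f x) && (y \in S).
  by rewrite (mem_rem_uniq _ uS) !inE.
have szr : (size (rem (f x) S)).+1 = size S.
  by rewrite size_rem // prednK // lt0n size_eq0; apply: contraTneq fxS => ->.
have [|||y|H [uH szH sH HP HN]] := IH (rem (f x) S).
- by move: leS => /=; lia.
- exact: rem_uniq.
- move=> y; rewrite !remE => /andP[yfx yS].
  have /= := Sf y; rewrite !inE yS orbT => /(_ isT) /orP[/eqP e|->].
    by rewrite -e fK eqxx in yfx.
  rewrite andbT (inj_eq (inv_inj fK)).
  by apply: contraTneq yS => ->.
- by rewrite remE => /andP[_ yS]; apply: fN0; rewrite inE yS orbT.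
have xH : x \notin H by apply: contra xS => /sH; rewrite remE => /andP[].
have fxH : f x \notin H by apply/negP => /sH; rewrite remE eqxx.
exists (x :: H); split => /=.
- by rewrite xH.
- by move: szH szr; lia.
- by move=> y; rewrite !inE => /orP[->//|/sH]; rewrite remE => /andP[_ ->]; rewrite orbT.
- move=> y; rewrite inE => /orP[/eqP->|yS]; first by left; rewrite mem_head.
  have [->|yfx] := eqVneq y (f x); first by right; rewrite fK mem_head.
  by have [|yH|yH] := HP y; rewrite ?remE ?yfx //; [left|right]; rewrite inE yH orbT.
- move=> y; rewrite !inE => /orP[/eqP->|yH].
    by rewrite (negPf fxH) orbF fN0 // mem_head.
  rewrite (negPf (HN _ yH)) orbF; apply: contraNneq fxH => <-.
  by rewrite fK.
Qed.

(** * Fox calculus at t = -1 *)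

(** The value of [t^d] at [t = -1]; passing to [|d|] is harmless because only the parity of [d]
    counts. *)
Definition zsign (d : int) : int := (-1) ^+ `|d|%N.

Lemma zsignN d : zsign (- d) = zsign d.
Proof. by rewrite /zsign abszN. Qed.

Lemma zsignK d : zsign d * zsign d = 1.
Proof. by rewrite -expr2 sqrr_sign. Qed.

Lemma normr_zsign d : `|zsign d| = 1.
Proof. by rewrite /zsign normrX normrN1 expr1n. Qed.

(** Integer values let the result serve as an exponent. The factor [zsign (deg j)] covers both kinds
    of letters, since [t^d] and [t^-d] agree at [-1]. *)
Fixpoint fox_at_m1 (I : eqType) (deg : I -> int) (i : I) (w : word I) : int :=
  if w is (j, b) :: w' then
    (if b then (j == i)%:R else - zsign (deg j) * (j == i)%:R)
    + zsign (deg j) * fox_at_m1 deg i w'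
  else 0.

(* The element x of Z[t, 1/t] takes the value c at t = -1. *)
Definition value_at_m1 (x : {fraction {poly int}}) (c : int) : Prop :=
  exists (n : nat) (p : {poly int}),
    x * tvar ^+ n = tofrac p /\ p.[-1] = (-1) ^+ n * c.

Lemma value_at_m1_tofrac p : value_at_m1 (tofrac p) p.[-1].
Proof. by exists 0%N, p; rewrite !expr0 mulr1 mul1r. Qed.

Lemma value_at_m1_int (z : int) : value_at_m1 z%:~R z.
Proof. by exists 0%N, (z%:P); rewrite !expr0 mulr1 mul1r hornerC -[z in z%:P]intz !rmorph_int. Qed.

Lemma value_at_m1D x y c d :
  value_at_m1 x c -> value_at_m1 y d -> value_at_m1 (x + y) (c + d).
Proof.
move=> [m [p [px pc]]] [n [q [qy qd]]]; exists (m + n)%N, (p * 'X^n + q * 'X^m).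
rewrite !hornerE pc qd rmorphD !rmorphM !rmorphXn /= -px -qy -/tvar !exprD.
split; ring.
Qed.

Lemma value_at_m1M x y c d :
  value_at_m1 x c -> value_at_m1 y d -> value_at_m1 (x * y) (c * d).
Proof.
move=> [m [p [px pc]]] [n [q [qy qd]]]; exists (m + n)%N, (p * q).
rewrite !hornerE pc qd rmorphM /= -px -qy !exprD.
split; ring.
Qed.

Lemma tvar_neq0 : tvar != 0.
Proof. by rewrite /tvar tofrac_eq0 polyX_eq0. Qed.

Lemma value_at_m1_tvar (k : int) : value_at_m1 (tvar ^ k) (zsign k).
Proof.
case: k => n; first by have := value_at_m1_tofrac 'X^n; rewrite rmorphXn /= !hornerE.
exists n.+1, 1; rewrite rmorph1 hornerC NegzE -exprz_inv -[_ ^ n.+1]/(_ ^+ _).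
by rewrite exprVn mulVf ?expf_neq0 ?tvar_neq0 // zsignN /zsign /= -expr2 sqrr_sign.
Qed.

Lemma value_at_m1N x c : value_at_m1 x c -> value_at_m1 (- x) (- c).
Proof.
by move=> xc; rewrite -mulN1r -[- c]mulN1r; apply: value_at_m1M xc; apply: (value_at_m1_int (-1)).
Qed.

(** Clearing denominators by [t^n] multiplies the value by [(-1)^n], which cancels. *)
Lemma value_at_m1_inj p c : value_at_m1 (tofrac p) c -> p.[-1] = c.
Proof.
move=> [n [q [/eqP + qc]]]; rewrite /tvar -rmorphXn -rmorphM /= tofrac_eq => /eqP e.
move: qc; rewrite -e !hornerE [RHS]mulrC => /mulIf -> //.
by rewrite expf_eq0 oppr_eq0 oner_eq0 andbF.
Qed.

Lemma value_at_m1_fox (I : eqType) (deg : I -> int) i w :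
  value_at_m1 (fox deg i w) (fox_at_m1 deg i w).
Proof.
elim: w => [|[j b] w IH] /=; first exact: (value_at_m1_int 0).
have vd : value_at_m1 (j == i)%:R (j == i)%:R.
  by have := value_at_m1_int (j == i)%:R; rewrite mulrz_nat.
apply: value_at_m1D.
  case: b => //; apply: value_at_m1M => //; apply: value_at_m1N.
  by rewrite -zsignN; apply: value_at_m1_tvar.
apply: value_at_m1M => //; case: b; last rewrite -zsignN; exact: value_at_m1_tvar.
Qed.

(** Leibniz expansion, as values at [-1] are compatible with sums and products. *)
Lemma value_at_m1_det (q : nat) (A : 'M[{fraction {poly int}}]_q) (F : 'M[int]_q) :
  (forall i j, value_at_m1 (A i j) (F i j)) -> value_at_m1 (\det A) (\det F).
Proof.
move=> AF; apply: (big_ind2 value_at_m1) => [||g _].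
- exact: (value_at_m1_int 0).
- by move=> *; apply: value_at_m1D.
apply: value_at_m1M.
  by have := value_at_m1_int ((-1) ^+ perm.odd_perm g); rewrite rmorph_sign.
apply: (big_ind2 value_at_m1) => //; first exact: (value_at_m1_int 1).
by move=> *; apply: value_at_m1M.
Qed.

(** * Words and group presentations *)

Section Groups.
Local Open Scope group_scope.

Definition gexpz (G : groupType) (a : G) (z : int) : G :=
  if z is Negz n then a ^- n.+1 else a ^+ `|z|%N.

Lemma word_eval_cat (G : groupType) (I : Type) (y : I -> G) u v :
  word_eval y (u ++ v) = word_eval y u * word_eval y v.
Proof. by elim: u => [|[i b] u IH] /=; rewrite ?mul1g // IH mulgA. Qed.

Lemma word_eval_map (G : groupType) (I J : Type) (h : I -> J) (y : J -> G) w :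
  word_eval y (word_map h w) = word_eval (y \o h) w.
Proof. by elim: w => [|[i b] w IH] //=; rewrite IH. Qed.

Lemma word_eval_exp (G : groupType) (I : Type) (y : I -> G) i z :
  word_eval y (word_exp i z) = gexpz (y i) z.
Proof.
have evalE b n : word_eval y (nseq n (i, b)) = (if b then y i else (y i)^-1) ^+ n.
  by elim: n => //= n ->; rewrite expgS.
by case: z => n; rewrite /word_exp evalE //= expVgn.
Qed.

Lemma word_eval_congr (G : groupType) (I : eqType) (rels : seq (word I)) (y : I -> G) u v :
  (forall r, r \in rels -> word_eval y r = 1) -> word_eq rels u v ->
  word_eval y u = word_eval y v.
Proof.
move=> y_rels; elim=> {u v} // [u v w _ -> _ -> //|u v u' v' _ e _ e'|i b].
  by rewrite !word_eval_cat e e'.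
by case: b => /=; rewrite mulg1 ?mulgV ?mulVg.
Qed.

Section Morphisms.
Variables (G H : groupType) (f : G -> H).
Hypothesis fM : forall a b, f (a * b) = f a * f b.

Lemma gmorph1 : f 1 = 1.
Proof. by apply: (mulgI (f 1)); rewrite -fM !mulg1. Qed.

Lemma gmorphV a : f a^-1 = (f a)^-1.
Proof. by apply: (mulgI (f a)); rewrite -fM !mulgV gmorph1. Qed.

Lemma gmorph_gexpz a z : f (gexpz a z) = gexpz (f a) z.
Proof.
have fX n : f (a ^+ n) = f a ^+ n.
  by elim: n => [|n IH]; rewrite ?gmorph1 // !expgS fM IH.
by case: z => n /=; rewrite ?gmorphV fX.
Qed.

Lemma gmorph_word_eval (I : Type) (y : I -> G) w :
  f (word_eval y w) = word_eval (f \o y) w.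
Proof.
elim: w => [|[i b] w IH] /=; first exact: gmorph1.
by rewrite fM IH; case: b; rewrite ?gmorphV.
Qed.

Lemma gmorph_derived a : derived_subgroup a -> derived_subgroup (f a).
Proof.
elim=> {a} [a b||a b _ IHa _ IHb|a _ IHa].
- by rewrite !fM !gmorphV; apply: DerCommutator.
- by rewrite gmorph1; apply: DerOne.
- by rewrite fM; apply: DerMul.
- by rewrite gmorphV; apply: DerInv.
Qed.

End Morphisms.

(** The conjugate is [a] times the commutator of [a] and [b]. *)
Lemma derived_conj (G : groupType) (a b : G) :
  derived_subgroup a -> derived_subgroup (b^-1 * (a * b)).
Proof.
move=> Na; have := DerMul Na (DerCommutator a b).
by rewrite !mulgA mulgV mul1g.
Qed.

Lemma presents_ind (G : groupType) (I : eqType) (y : I -> G) rels (P : G -> Prop) :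
  presents y rels -> (forall a b, P a -> P b -> P (a * b)) ->
  (forall a, P a -> P a^-1) -> P 1 -> (forall i, P (y i)) -> forall a, P a.
Proof.
move=> [gen _] PM PV P1 Py a; have [w <-] := gen a.
elim: w => [|[i b] w IH] //=; apply: PM => //.
by case: b; [|apply: PV]; apply: Py.
Qed.

(** Von Dyck: a word is chosen for each element, and two words for the same element take the same
    value at [f] because [f] satisfies the relators. *)
Lemma presents_morph (G H : groupType) (I : eqType) (y : I -> G) rels (f : I -> H) :
  presents y rels -> (forall r, r \in rels -> word_eval f r = 1) ->
  exists phi : G -> H, (forall a b, phi (a * b) = phi a * phi b) /\
    (forall i, phi (y i) = f i).
Proof.
move=> [gen yE] f_rels; have [wd wdE] := choice gen.
have E w : word_eval f (wd (word_eval y w)) = word_eval f w.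
  by apply: (word_eval_congr f_rels); apply/yE; rewrite wdE.
exists (fun a => word_eval f (wd a)); split => [a b|i].
  by rewrite -word_eval_cat -[RHS]E word_eval_cat !wdE.
by have := E [:: (i, true)]; rewrite /= !mulg1.
Qed.

Lemma gexpz_closed (G : groupType) (P : G -> Prop) a z :
  (forall a b, P a -> P b -> P (a * b)) -> (forall a, P a -> P a^-1) -> P 1 ->
  P a -> P (gexpz a z).
Proof.
move=> PM PV P1 Pa; have PX n : P (a ^+ n).
  by elim: n => // n IH; rewrite expgS; apply: PM.
by case: z => n; [apply: PX | apply: PV; apply: PX].
Qed.

End Groups.

(** Serves for the image of [h], whose square is trivial: only the parity of [beta] matters
    there. *)
Lemma gexpz_involution (G : groupType) (a : G) (n : int) :
  (a * a = 1)%g -> gexpz a n = if odd `|n|%N then a else 1%g.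
Proof.
move=> a2; have aV : (a^-1)%g = a by apply: (mulgI a); rewrite mulgV a2.
have aX k : (a ^+ k)%g = if odd k then a else 1%g.
  rewrite -{1}(odd_double_half k) -mul2n expgnDr expgnA expg2 a2 expg1n mulg1.
  by case: odd.
by case: n => k; rewrite /= aX //=; case: (odd k); rewrite /= ?aV ?invg1.
Qed.

Lemma gmorph_derived_trivial (G H : groupType) (f : G -> H) :
  (forall a b, f (a * b) = f a * f b)%g -> (forall a b, f a * f b = f b * f a)%g ->
  forall a, derived_subgroup a -> f a = 1%g.
Proof.
move=> fM fC a; elim=> {a} [a b||a b _ IHa _ IHb|a _ IHa].
- by rewrite !fM !gmorphV // (fC a) (mulgA (f b)^-1%g) mulVg mul1g mulVg.
- exact: gmorph1.
- by rewrite fM IHa IHb mulg1.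
- by rewrite gmorphV // IHa invg1.
Qed.

Fixpoint word_deg (I : Type) (deg : I -> int) (w : word I) : int :=
  if w is (j, b) :: w' then (if b then deg j else - deg j) + word_deg deg w' else 0.

Section AbelianizationToInt.
Variables (G : groupType) (ab : G -> int).
Hypothesis abM : forall a b, ab (a * b)%g = ab a + ab b.

Lemma ab1 : ab 1%g = 0.
Proof. by apply: (addrI (ab 1%g)); rewrite -abM mulg1 addr0. Qed.

Lemma abV a : ab (a^-1)%g = - ab a.
Proof. by apply/eqP; rewrite -addr_eq0 -abM mulVg ab1. Qed.

Lemma ab_gexpz a z : ab (gexpz a z) = ab a * z.
Proof.
have abX n : ab (a ^+ n)%g = ab a * n%:Z.
  by elim: n => [|n IH]; rewrite ?ab1 ?mulr0 // expgS abM IH; lia.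
by case: z => n /=; rewrite ?abV abX //; lia.
Qed.

Lemma ab_word_eval (I : Type) (y : I -> G) w :
  ab (word_eval y w) = word_deg (fun i => ab (y i)) w.
Proof. by elim: w => [|[i b] w IH] /=; rewrite ?ab1 // abM IH; case: b; rewrite ?abV. Qed.

End AbelianizationToInt.

(** * Two by two matrices *)

Section Matrices2.
Variable F : fieldType.

Definition mat2 (a b c d : F) : 'M[F]_2 :=
  \matrix_(i, j) if i == 0 then (if j == 0 then a else b) else (if j == 0 then c else d).

Lemma ord2P (P : 'I_2 -> Prop) : P 0 -> P 1 -> forall i, P i.
Proof.
by move=> P0 P1 [[|[|//]] lti]; [rewrite (_ : Ordinal _ = 0)|rewrite (_ : Ordinal _ = 1)] => //;
  apply: val_inj.
Qed.

Lemma mat2_eta (M : 'M[F]_2) : M = mat2 (M 0 0) (M 0 1) (M 1 0) (M 1 1).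
Proof. by apply/matrixP; apply: ord2P; apply: ord2P; rewrite mxE. Qed.

Lemma mat2_inj a b c d a' b' c' d' :
  mat2 a b c d = mat2 a' b' c' d' -> [/\ a = a', b = b', c = c' & d = d'].
Proof.
move=> /matrixP e.
by split; [move: (e 0 0)|move: (e 0 1)|move: (e 1 0)|move: (e 1 1)]; rewrite !mxE.
Qed.

Lemma mulmx_mat2 a b c d a' b' c' d' :
  mat2 a b c d *m mat2 a' b' c' d' =
  mat2 (a * a' + b * c') (a * b' + b * d') (c * a' + d * c') (c * b' + d * d').
Proof.
by apply/matrixP; apply: ord2P; apply: ord2P; rewrite !mxE !big_ord_recl big_ord0 !mxE /= addr0.
Qed.

Lemma mulr_mat2 a b c d a' b' c' d' :
  mat2 a b c d * mat2 a' b' c' d' =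
  mat2 (a * a' + b * c') (a * b' + b * d') (c * a' + d * c') (c * b' + d * d').
Proof. exact: mulmx_mat2. Qed.

Lemma det_mat2 a b c d : \det (mat2 a b c d) = a * d - b * c.
Proof.
rewrite (expand_det_row _ 0) !big_ord_recl big_ord0 /cofactor !det_mx11 !mxE /=.
by rewrite expr0 expr1; ring.
Qed.

Lemma scalar_mat2 a : a%:M = mat2 a 0 0 a.
Proof. by apply/matrixP; apply: ord2P; apply: ord2P; rewrite !mxE. Qed.

Definition diag2 (x : F) : 'M[F]_2 := mat2 x 0 0 x^-1.

(** The matrix [J], the image of the meridian [y_0] in the normal form. *)
Definition rot2 : 'M[F]_2 := mat2 0 1 (-1) 0.

Lemma diag2M x y : diag2 (x * y) = diag2 x * diag2 y.
Proof.
by rewrite /diag2 mulr_mat2 !mul0r !mulr0 !addr0 !add0r invfM.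
Qed.

Lemma diag2_1 : diag2 1 = 1.
Proof. by rewrite /diag2 invr1 -scalar_mat2. Qed.

Lemma det_diag2 x : x != 0 -> \det (diag2 x) = 1.
Proof. by move=> x0; rewrite det_mat2 mulr0 subr0 divff. Qed.

Lemma diag2_unit x : x != 0 -> diag2 x \is a GRing.unit.
Proof. by move=> x0; rewrite -[_ \is a _]/(_ \in unitmx) unitmxE det_diag2 ?unitr1. Qed.

Lemma diag2V x : x != 0 -> (diag2 x)^-1 = diag2 x^-1.
Proof.
move=> x0; apply: (mulrI (diag2_unit x0)).
by rewrite mulrV ?diag2_unit // -diag2M divff // diag2_1.
Qed.

Lemma det_rot2 : \det rot2 = 1.
Proof. by rewrite det_mat2; ring. Qed.

Lemma rot2_unit : rot2 \is a GRing.unit.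
Proof. by rewrite -[_ \is a _]/(_ \in unitmx) unitmxE det_rot2 ?unitr1. Qed.

Lemma rot2_sqr : rot2 ^+ 2 = (-1)%:M.
Proof.
rewrite expr2 /rot2 mulr_mat2 scalar_mat2.
by congr mat2; ring.
Qed.

Lemma rot2_diag2 x : rot2 * diag2 x = diag2 x^-1 * rot2.
Proof.
rewrite /rot2 /diag2 !mulr_mat2 invrK.
by congr mat2; ring.
Qed.

(** Each [J] that passes [D(x)] inverts [x], so [J] acts on the diagonal torus as [t = -1]; this is
    why Fox derivatives get evaluated at [-1]. *)
Lemma rot2_exp_diag2 (d : int) x : x != 0 ->
  rot2 ^ d * diag2 x = diag2 (x ^ zsign d) * rot2 ^ d.
Proof.
have natE n y : rot2 ^+ n * diag2 y = diag2 (y ^ zsign n) * rot2 ^+ n.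
  elim: n => [|n IH]; first by rewrite expr0 mul1r mulr1.
  rewrite exprS -mulrA IH mulrA rot2_diag2 -mulrA; congr (diag2 _ * _).
  by rewrite /zsign /= exprS mulN1r -invr_expz.
case: d => n x0; first exact: natE.
rewrite NegzE zsignN -exprz_inv -[_ ^ n.+1]/(_ ^+ _) exprVn.
apply: (mulrI (unitrX n.+1 rot2_unit)); rewrite mulVKr ?unitrX ?rot2_unit //.
rewrite mulrA natE exprz_exp zsignK expr1z -mulrA mulrV ?mulr1 //.
by rewrite unitrX ?rot2_unit.
Qed.

Lemma rot2_even n : ~~ odd n -> rot2 ^+ n = ((-1) ^+ n./2)%:M.
Proof.
move=> n_even; rewrite -[n in LHS]odd_double_half (negPf n_even) add0n -mul2n exprM rot2_sqr.
by rewrite -rmorphXn.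
Qed.

(** Odd powers of [J] are [J] up to sign and have a nonzero entry off the diagonal. *)
Lemma rot2_odd_not_scalar n c : odd n -> rot2 ^+ n <> c%:M.
Proof.
move=> n_odd; rewrite -[n in LHS]odd_double_half n_odd add1n exprS rot2_even ?odd_double //.
rewrite !scalar_mat2 /rot2 mulr_mat2 => /mat2_inj[_ + _ _].
move/eqP; rewrite mul0r mul1r add0r.
by rewrite expf_eq0 oppr_eq0 oner_eq0 andbF.
Qed.

Lemma mulmx_entry2 m n (A : 'M[F]_(m, 2)) (B : 'M[F]_(2, n)) i j :
  (A *m B) i j = A i 0 * B 0 j + A i 1 * B 1 j.
Proof.
rewrite mxE !big_ord_recl big_ord0 addr0.
by congr (_ + A i _ * B _ j); apply: val_inj.
Qed.

Lemma col2P (v w : 'cV[F]_2) : v 0 0 = w 0 0 -> v 1 0 = w 1 0 -> v = w.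
Proof. by move=> e0 e1; apply/matrixP; apply: ord2P => j; rewrite (ord1 j). Qed.

Lemma col2_neq0 (v : 'cV[F]_2) : v != 0 -> v 0 0 != 0 \/ v 1 0 != 0.
Proof.
move=> v0; have [v00|] := eqVneq (v 0 0) 0; last by left.
right; apply: contraNneq v0 => v10; apply/eqP.
by apply: col2P; rewrite mxE.
Qed.

Definition cols2 (p q : 'cV[F]_2) : 'M[F]_2 :=
  \matrix_(i, j) if j == 0 then p i 0 else q i 0.

Lemma mulmx_cols2 M p q : M *m cols2 p q = cols2 (M *m p) (M *m q).
Proof.
by apply/matrixP => i; apply: ord2P; rewrite [RHS]mxE !mulmx_entry2 !mxE.
Qed.

Lemma cols2_mulmx p q a b c d :
  cols2 p q *m mat2 a b c d = cols2 (a *: p + c *: q) (b *: p + d *: q).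
Proof.
by apply/matrixP => i; apply: ord2P; rewrite mulmx_entry2 !mxE /=; ring.
Qed.

Lemma det_cols2 p q : \det (cols2 p q) = p 0 0 * q 1 0 - q 0 0 * p 1 0.
Proof. by rewrite [cols2 p q]mat2_eta det_mat2 !mxE. Qed.

Lemma cols2Z k p q : cols2 (k *: p) (k *: q) = k *: cols2 p q.
Proof. by apply/matrixP => i; apply: ord2P; rewrite !mxE. Qed.

Lemma col2_parallel (v w : 'cV[F]_2) : v != 0 -> v 0 0 * w 1 0 = v 1 0 * w 0 0 ->
  exists k, w = k *: v.
Proof.
move=> /col2_neq0[] vi0 e; [exists (w 0 0 / v 0 0)|exists (w 1 0 / v 1 0)].
  by apply: col2P; rewrite !mxE ?divfK // mulrAC [w 0 0 * _]mulrC -e mulrAC divff ?mul1r.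
by apply: col2P; rewrite !mxE ?divfK // mulrAC [w 1 0 * _]mulrC e mulrAC divff ?mul1r.
Qed.

(** Were the minor of [v] and [w] nonzero, Cramer's rule would make every row of [M] vanish. *)
Lemma kernel2_line (M : 'M[F]_2) (v w : 'cV[F]_2) : M != 0 -> M *m v = 0 -> M *m w = 0 -> v != 0 ->
  exists k, w = k *: v.
Proof.
move=> M0 Mv Mw v0; apply: col2_parallel => //.
have rowE i : M i 0 * v 0 0 + M i 1 * v 1 0 = 0 /\ M i 0 * w 0 0 + M i 1 * w 1 0 = 0.
  by rewrite -!mulmx_entry2 Mv Mw !mxE.
apply/eqP; rewrite -subr_eq0; apply: contraNT M0 => det0; apply/eqP/matrixP => i.
have [eV eW] := rowE i; apply: ord2P; rewrite [RHS]mxE; apply/(mulIf det0); rewrite mul0r.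
  transitivity ((M i 0 * v 0 0 + M i 1 * v 1 0) * w 1 0
    - (M i 0 * w 0 0 + M i 1 * w 1 0) * v 1 0); first by ring.
  by rewrite eV eW !mul0r subr0.
transitivity ((M i 0 * w 0 0 + M i 1 * w 1 0) * v 0 0
  - (M i 0 * v 0 0 + M i 1 * v 1 0) * w 0 0); first by ring.
by rewrite eV eW !mul0r subr0.
Qed.

End Matrices2.

(** * Eigenvectors of two by two matrices *)

Section EigenvectorSL2.
Variable C : numClosedFieldType.

Lemma eigenvector2 (M : 'M[C]_2) : exists2 v : 'cV[C]_2, v != 0 & exists c, M *m v = c *: v.
Proof.
pose a := M 0 0; pose b := M 0 1; pose c := M 1 0; pose d := M 1 1.
(* A root of the characteristic polynomial, by the quadratic formula. *)
pose l := (a + d + sqrtC ((a + d) ^+ 2 - 4 * (a * d - b * c))) / 2.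
have lE : (l - a) * (l - d) = b * c.
  have : (2 * l - (a + d)) ^+ 2 = (a + d) ^+ 2 - 4 * (a * d - b * c).
    rewrite /l [2 * _]mulrC divfK ?pnatr_eq0 // addrAC subrr add0r sqrtCK //.
  move=> e; apply: (@mulfI C 4); first by rewrite pnatr_eq0.
  apply/eqP; rewrite -subr_eq0; apply/eqP.
  transitivity ((2 * l - (a + d)) ^+ 2 - ((a + d) ^+ 2 - 4 * (a * d - b * c))); first by ring.
  by rewrite e subrr.
have vE x y : (x != 0) || (y != 0) -> a * x + b * y = l * x -> c * x + d * y = l * y ->
    exists2 v : 'cV[C]_2, v != 0 & exists c, M *m v = c *: v.
  move=> xy e0 e1; exists (\col_i if i == 0 then x else y).
    apply: contraTneq xy => /matrixP e; rewrite negb_or !negbK.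
    by have := e 0 0; have := e 1 0; rewrite !mxE /= => -> ->; rewrite eqxx.
  by exists l; apply: col2P; rewrite mulmx_entry2 !mxE.
(* For [b != 0] the vector [(b, l - a)] works, for [c != 0] the vector [(l - d, c)]; a diagonal
   matrix has the standard basis as eigenvectors. *)
have [b0|b0] := eqVneq b 0; last first.
  apply: (vE b (l - a)); rewrite ?b0 //; first by ring.
  transitivity (b * c + d * (l - a)); [|rewrite -lE]; ring.
have [c0|c0] := eqVneq c 0; last first.
  apply: (vE (l - d) c); rewrite ?c0 ?orbT //; last by ring.
  transitivity (b * c + a * (l - d)); [|rewrite -lE]; ring.
move/eqP: lE; rewrite b0 mul0r mulf_eq0 !subr_eq0 => /orP[]/eqP el.
  by apply: (vE 1 0); rewrite ?oner_eq0 // ?b0 ?c0 ?el; ring.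
by apply: (vE 0 1); rewrite ?oner_eq0 ?orbT // ?b0 ?c0 ?el; ring.
Qed.

End EigenvectorSL2.

(** * SL(2, F) as a group, the target of morphisms from presented groups *)

Definition SL2 (F : fieldType) := {M : 'M[F]_2 | \det M == 1}.

Section SL2Group.
Variable F : fieldType.

HB.instance Definition _ := SubChoice.copy (SL2 F) {M : 'M[F]_2 | \det M == 1}.

Definition toSL2 (M : 'M[F]_2) (detM : \det M = 1) : SL2 F :=
  exist (fun M : 'M[F]_2 => \det M == 1) M (introT eqP detM).

Lemma SL2_det (a : SL2 F) : \det (val a) = 1.
Proof. exact: (eqP (valP a)). Qed.

Lemma SL2_unit (a : SL2 F) : val a \in unitmx.
Proof. by rewrite unitmxE SL2_det unitr1. Qed.

Lemma SL2_mul_subproof (a b : SL2 F) : \det (val a *m val b) = 1.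
Proof. by rewrite det_mulmx !SL2_det mulr1. Qed.

Lemma SL2_inv_subproof (a : SL2 F) : \det (invmx (val a)) = 1.
Proof. by rewrite det_inv SL2_det invr1. Qed.

Definition SL2_one : SL2 F := toSL2 (det1 _ 2).
Definition SL2_mul (a b : SL2 F) : SL2 F := toSL2 (SL2_mul_subproof a b).
Definition SL2_inv (a : SL2 F) : SL2 F := toSL2 (SL2_inv_subproof a).

Lemma SL2_mulA : associative SL2_mul.
Proof. by move=> a b c; apply: val_inj; rewrite /= mulmxA. Qed.

Lemma SL2_mul1 : left_id SL2_one SL2_mul.
Proof. by move=> a; apply: val_inj; rewrite /= mul1mx. Qed.

Lemma SL2_mulr1 : right_id SL2_one SL2_mul.
Proof. by move=> a; apply: val_inj; rewrite /= mulmx1. Qed.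

Lemma SL2_mulV : left_inverse SL2_one SL2_inv SL2_mul.
Proof. by move=> a; apply: val_inj; rewrite /= mulVmx ?SL2_unit. Qed.

Lemma SL2_mulrV : right_inverse SL2_one SL2_inv SL2_mul.
Proof. by move=> a; apply: val_inj; rewrite /= mulmxV ?SL2_unit. Qed.

HB.instance Definition _ := isGroup.Build (SL2 F) SL2_mulA SL2_mul1 SL2_mulr1 SL2_mulV SL2_mulrV.

Lemma val_SL2M (a b : SL2 F) : val (a * b)%g = val a * val b.
Proof. by []. Qed.

Lemma val_SL2V (a : SL2 F) : val (a^-1)%g = (val a)^-1.
Proof. by []. Qed.

Lemma val_SL2_exp (a : SL2 F) z : val (gexpz a z) = val a ^ z.
Proof.
have valX n : val (a ^+ n)%g = val a ^+ n by elim: n => // n IH; rewrite expgS exprS -IH.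
by case: z => n /=; rewrite ?val_SL2V valX.
Qed.

End SL2Group.

(** * Words in monomial matrices and Fox derivatives *)

Section MonomialWords.
Variables (F : fieldType) (I : finType) (u : I -> F) (deg : I -> int) (f : I -> SL2 F).
Hypothesis u0 : forall i, u i != 0.
Hypothesis fE : forall i, val (f i) = diag2 (u i) * rot2 F ^ deg i.

(** Moving all powers of [J] to the right raises the entry of each letter to the sign [(-1)^d], with
    [d] the degree of the prefix before it; summing these signs for each generator is Fox's rule at
    [t = -1]. *)
Lemma word_eval_monomial w :
  val (word_eval f w) =
    diag2 (\prod_i u i ^ fox_at_m1 deg i w) * rot2 F ^ word_deg deg w.
Proof.
(* Separates the contribution [c] of the first letter from the exponents [k] of the remaining word,
   twisted by the sign [e]. *)
have prodE (c e : int) j (k : I -> int) :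
    \prod_i u i ^ (c * (j == i)%:R + e * k i) = u j ^ c * (\prod_i u i ^ k i) ^ e.
  have -> : (\prod_i u i ^ k i) ^ e = \prod_i u i ^ (e * k i).
    rewrite (big_morph _ (fun x y => expfzMl x y e) (exp1rz _ e)).
    by apply: eq_bigr => i _; rewrite exprz_exp mulrC.
  under eq_bigr do rewrite expfzDr //.
  rewrite big_split (bigD1 j) //= eqxx mulr1 [X in _ * X * _]big1 ?mulr1 // => i ij.
  by rewrite eq_sym (negPf ij) mulr0 expr0z.
have X0 w' : \prod_i u i ^ fox_at_m1 deg i w' != 0.
  by apply/prodf_neq0 => i _; rewrite expfz_neq0.
elim: w => [|[j b] w IH].
  by rewrite big1 ?expr0z ?diag2_1 ?mulr1.
have Ju := rot2_unit F.
have -> : val (word_eval f ((j, b) :: w)) =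
    (if b then val (f j) else (val (f j))^-1) * val (word_eval f w) by case: b.
rewrite fE IH /=; case: b; rewrite exprzDr // !mulrA; congr (_ * _).
  under [in RHS]eq_bigr do rewrite -[X in X + _]mul1r.
  by rewrite prodE expr1z diag2M -mulrA rot2_exp_diag2 // mulrA.
(* For an inverse letter, [(D(x) J^d)^-1 = J^-d D(1/x) = D(x^c) J^-d] with [c = - (-1)^d], the
   coefficient in [fox_at_m1]. *)
under [in RHS]eq_bigr do rewrite mulNr -mulNr.
rewrite prodE -mulN1r -exprz_exp -expfzMl exprN1 -zsignN.
rewrite -rot2_exp_diag2 ?mulf_neq0 ?invr_eq0 // diag2M mulrA; congr (_ * _).
by rewrite invrM ?diag2_unit ?unitrXz // diag2V // invr_expz.
Qed.

End MonomialWords.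

Section Monomial.
Variable F : fieldType.

(** The exponent of [J] is kept as a degree: it adds up under products and cancels in
    commutators. *)
Definition monomial2 (M : 'M[F]_2) (k : int) :=
  exists2 x, x != 0 & M = diag2 x * rot2 F ^ k.

Lemma monomial2M M N k l : monomial2 M k -> monomial2 N l -> monomial2 (M * N) (k + l).
Proof.
move=> [x x0 ->] [y y0 ->]; exists (x * y ^ zsign k); first by rewrite mulf_neq0 ?expfz_neq0.
by rewrite exprzDr ?rot2_unit // diag2M -!mulrA; congr (_ * _); rewrite !mulrA rot2_exp_diag2.
Qed.

Lemma monomial2V M k : monomial2 M k -> monomial2 M^-1 (- k).
Proof.
move=> [x x0 ->]; exists (x^-1 ^ zsign k); first by rewrite expfz_neq0 ?invr_eq0.
rewrite -zsignN -rot2_exp_diag2 ?invr_eq0 //.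
by rewrite invrM ?diag2_unit ?unitrXz ?rot2_unit // diag2V // invr_expz.
Qed.

End Monomial.

(** * Normal form of irreducible metabelian representations *)

Section ConjugationOfRepresentations.
Variables (R : realType) (G : groupType).
Implicit Types rho : G -> 'M[R[i]]_2.

Lemma det1_unit (P : 'M[R[i]]_2) : \det P = 1 -> P \in unitmx.
Proof. by move=> dP; rewrite unitmxE dP unitr1. Qed.

Lemma SL2_conjugate_sym rho rho' : SL2_conjugate rho rho' -> SL2_conjugate rho' rho.
Proof.
move=> [P dP e]; have Pu := det1_unit dP.
exists (invmx P) => [|a]; first by rewrite det_inv dP invr1.
by rewrite e invmxK !mulmxA mulVmx // mul1mx mulmxKV.
Qed.

Lemma SL2_conjugate_trans rho1 rho2 rho3 :
  SL2_conjugate rho1 rho2 -> SL2_conjugate rho2 rho3 -> SL2_conjugate rho1 rho3.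
Proof.
move=> [P dP e] [Q dQ e']; exists (Q *m P) => [|a]; first by rewrite det_mulmx dP dQ mulr1.
rewrite e' e !mulmxA; have -> : invmx (Q *m P) = invmx P *m invmx Q.
  exact: (@invrM _ Q P (det1_unit dQ) (det1_unit dP)).
by rewrite !mulmxA.
Qed.

Lemma SL2_conjugate_class rho rho' : SL2_conjugate rho rho' ->
  [set r | SL2_conjugate rho r]%classic = [set r | SL2_conjugate rho' r]%classic.
Proof.
move=> c; apply/seteqP; split => r /=; apply: SL2_conjugate_trans => //.
exact: SL2_conjugate_sym.
Qed.

Lemma SL2_conjugate_irreducible rho rho' :
  SL2_conjugate rho rho' -> irreducible rho -> irreducible rho'.
Proof.
move=> [P dP e] irr [v v0 stab]; apply: irr; have Pu := det1_unit dP.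
exists (invmx P *m v).
  by apply: contraNneq v0 => Pv; rewrite -[v](mulKVmx Pu) Pv mulmx0.
move=> a; have [c ac] := stab a; exists c.
by rewrite scalemxAr -ac e -!mulmxA mulKmx.
Qed.

Lemma SL2_conjugate_rep rho rho' :
  SL2_conjugate rho rho' -> SL2_representation rho -> SL2_representation rho'.
Proof.
move=> [P dP e] [det1 rM]; split => [a|a b].
  by rewrite e !det_mulmx det1 det_inv dP invr1 !mulr1.
by rewrite !e rM -!mulmxA (mulKmx (det1_unit dP)).
Qed.

End ConjugationOfRepresentations.

Section NormalForm.
Variables (R : realType) (G : groupType) (rho : G -> 'M[R[i]]_2).
Hypothesis rho_rep : SL2_representation rho.

(** Makes the facts about group morphisms available for [rho], whose values are plain matrices. *)
Lemma rep_lift : exists phi : G -> SL2 R[i],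
  (forall a b, phi (a * b)%g = (phi a * phi b)%g) /\ (forall a, val (phi a) = rho a).
Proof.
have [det1 rhoM] := rho_rep; exists (fun a => toSL2 (det1 a)).
by split => // a b; apply: val_inj; rewrite /= rhoM.
Qed.

Lemma rep1 : rho 1%g = 1%:M.
Proof. by have [phi [phiM phiE]] := rep_lift; rewrite -phiE gmorph1. Qed.

Lemma repV a : rho (a^-1)%g = invmx (rho a).
Proof. by have [phi [phiM phiE]] := rep_lift; rewrite -!phiE gmorphV. Qed.

Lemma rep_unit a : rho a \in unitmx.
Proof. by rewrite unitmxE (proj1 rho_rep) unitr1. Qed.

Definition stable_line (v : 'cV[R[i]]_2) a := exists c, rho a *m v = c *: v.

Lemma stable_lineM v a b :
  stable_line v a -> stable_line v b -> stable_line v (a * b)%g.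
Proof.
move=> [c ac] [d bd]; exists (d * c).
by rewrite (proj2 rho_rep) -mulmxA bd -scalemxAr ac scalerA.
Qed.

Lemma stable_lineV v a : stable_line v a -> stable_line v (a^-1)%g.
Proof.
move=> [c ac]; exists c^-1; rewrite repV.
(* A zero eigenvalue occurs only for [v = 0], since [rho a] is invertible. *)
have [c0|c0] := eqVneq c 0.
  have v0 : v = 0 by rewrite -[v](mulKmx (rep_unit a)) ac c0 scale0r mulmx0.
  by rewrite v0 mulmx0 scaler0.
by rewrite -[v in LHS](scalerK c0) -ac -scalemxAr mulKmx ?rep_unit.
Qed.

Lemma stable_line1 v : stable_line v 1%g.
Proof. by exists 1; rewrite rep1 mul1mx scale1r. Qed.

Hypothesis rho_irr : irreducible rho.

Lemma rep_gexpz a n : rho (gexpz a n) = (rho a) ^ n.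
Proof. by have [phi [phiM phiE]] := rep_lift; rewrite -!phiE gmorph_gexpz // val_SL2_exp. Qed.

Lemma irreducible_line v : v != 0 -> ~ (forall a, stable_line v a).
Proof. by move=> v0 all; apply: rho_irr; exists v. Qed.

(** Schur's lemma: for an eigenvalue [c] of [M] the kernel of [M - c] is stable under [rho]; if
    [M - c] were nonzero, this kernel would be an invariant line. *)
Lemma schur2 (M : 'M[R[i]]_2) : (forall a, M *m rho a = rho a *m M) -> exists c, M = c%:M.
Proof.
move=> comm; have [v v0 [c Mv]] := eigenvector2 M; exists c; apply/eqP.
rewrite -subr_eq0; apply/negPn/negP => M0; apply: (irreducible_line v0) => a.
apply: (kernel2_line M0) => //; first by rewrite mulmxBl Mv mul_scalar_mx subrr.
by rewrite mulmxBl mulmxA comm -mulmxA Mv -scalemxAr mul_scalar_mx subrr.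
Qed.

Variables (z0 h : G).
Hypothesis h_central : forall a, (h * a = a * h)%g.
Hypothesis generation : forall P : G -> Prop,
  (forall a b, P a -> P b -> P (a * b)%g) -> (forall a, P a -> P (a^-1)%g) -> P 1%g ->
  (forall a, derived_subgroup a -> P a) -> P z0 -> P h -> forall a, P a.
Hypothesis rho_metab : metabelian rho.

Lemma rep_central : exists2 e : R[i], e ^+ 2 = 1 & rho h = e%:M.
Proof.
have [e he] : exists e, rho h = e%:M.
  by apply: schur2 => a; rewrite -!(proj2 rho_rep) h_central.
by exists e => //; rewrite -det_scalar -he (proj1 rho_rep).
Qed.

(** The scalar [rho h] preserves every line, so only [G'] and [z0] have to be checked. *)
Lemma generated_line v : (forall a, derived_subgroup a -> stable_line v a) ->
  stable_line v z0 -> forall a, stable_line v a.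
Proof.
move=> vN vz; apply: generation => //.
- by move=> a b; apply: stable_lineM.
- by move=> a; apply: stable_lineV.
- exact: stable_line1.
- by have [e _ he] := rep_central; exists e; rewrite he mul_scalar_mx.
Qed.

(** Otherwise [G'] would act by scalars, and an eigenvector of [rho z0] would span an invariant
    line. *)
Lemma derived_not_scalar :
  exists2 b, derived_subgroup b & forall c, rho b <> c%:M.
Proof.
apply: contrapT => noB.
have scalN b : derived_subgroup b -> exists c, rho b = c%:M.
  move=> Nb; apply: contrapT => nc; apply: noB; exists b => // c e.
  by apply: nc; exists c.
have [e1 e1_neq0 [c z0c]] := eigenvector2 (rho z0).
apply: (irreducible_line e1_neq0); apply: generated_line; last by exists c.
by move=> a /scalN[d ad]; exists d; rewrite ad mul_scalar_mx.
Qed.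

(** The commuting matrices in [rho(G')] share an eigenvector [w]; since [G'] is normal, [rho z0 w]
    is another one. In the basis [(w, - rho z0 w)], scaled to determinant 1, [G'] is diagonal and
    [z0] turns out to be [J]. *)
Lemma normal_form : exists P : 'M[R[i]]_2, [/\ \det P = 1,
    forall a, derived_subgroup a -> exists2 x, x != 0 & invmx P *m rho a *m P = diag2 x
  & invmx P *m rho z0 *m P = rot2 _].
Proof.
have [b Nb bN] := derived_not_scalar.
have [v v0 [l Bv]] := eigenvector2 (rho b).
have BlN : rho b - l%:M != 0 by rewrite subr_eq0; apply/eqP/bN.
(* The kernel of [rho b - l] is the line of [v], and every matrix commuting with [rho b] preserves
   it. *)
have Nv a : derived_subgroup a -> stable_line v a.
  move=> Na; apply: (kernel2_line BlN) => //; first by rewrite mulmxBl Bv mul_scalar_mx subrr.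
  rewrite mulmxBl mulmxA rho_metab // -mulmxA Bv.
  by rewrite -scalemxAr mul_scalar_mx subrr.
(* v spans a line stable under G', hence not stable under z0. *)
have detQ : \det (cols2 v (- (rho z0 *m v))) != 0.
  apply/negP => /eqP; rewrite det_cols2 !mxE => dQ; apply: (irreducible_line v0).
  apply: generated_line => //; apply: col2_parallel => //.
  apply/eqP; rewrite -subr_eq0 -oppr_eq0 -[X in _ == X]dQ !mxE; apply/eqP; ring.
have [w [Nw detw]] : exists w, (forall a, derived_subgroup a -> stable_line w a) /\
    \det (cols2 w (- (rho z0 *m w))) = 1.
  (* Scaling [v] by [1/s] divides the determinant by [s^2]. *)
  pose s := sqrtC (\det (cols2 v (- (rho z0 *m v)))).
  have s0 : s != 0 by rewrite sqrtC_eq0.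
  exists (s^-1 *: v); split.
    by move=> a /Nv[c ac]; exists c; rewrite -scalemxAr ac !scalerA mulrC.
  by rewrite -scalemxAr -scalerN cols2Z detZ exprVn sqrtCK mulVf.
have [w' w'E] : exists w', w' = rho z0 *m w by exists (rho z0 *m w).
rewrite -w'E in detw.
have [P PE] : exists P, P = cols2 w (- w') by exists (cols2 w (- w')).
have detP : \det P = 1 by rewrite PE.
have Pu : P \in unitmx by rewrite unitmxE detP unitr1.
have colP M M' : M *m P = P *m M' -> invmx P *m M *m P = M'.
  by move=> e; rewrite -mulmxA e mulKmx.
have Nw' a : derived_subgroup a -> stable_line w' a.
  move=> Na; have [y cy] := Nw _ (derived_conj z0 Na); exists y.
  rewrite w'E {1}(_ : a = (z0 * (z0^-1 * (a * z0)) * z0^-1)%g); last first.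
    by rewrite !mulgA mulgV mul1g mulgK.
  rewrite !(proj2 rho_rep) repV -!mulmxA mulKmx ?rep_unit //.
  by move: cy; rewrite !(proj2 rho_rep) repV -!mulmxA => ->; rewrite -scalemxAr.
have Ndiag a : derived_subgroup a -> exists2 x, x != 0 & invmx P *m rho a *m P = diag2 x.
  move=> Na; have [x ax] := Nw a Na; have [y ay] := Nw' a Na.
  have e : invmx P *m rho a *m P = mat2 x 0 0 y.
    by apply: colP; rewrite PE mulmx_cols2 cols2_mulmx mulmxN ax ay !scale0r addr0 add0r scalerN.
  have := congr1 (fun M => \det M) e.
  rewrite !det_mulmx det_inv detP (proj1 rho_rep) det_mat2 invr1 !mulr1 mulr0 subr0 => xy.
  have x0 : x != 0 by apply: contra_eq_neq xy => ->; rewrite mul0r oner_neq0.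
  exists x => //; rewrite e /diag2; congr mat2.
  by rewrite -[y](mulKf x0) -xy mulr1.
exists P; split => //.
have [M ME] : exists M, M = invmx P *m rho z0 *m P by exists (invmx P *m rho z0 *m P).
have detM : \det M = 1 by rewrite ME !det_mulmx det_inv detP (proj1 rho_rep) invr1 !mulr1.
have M0 : P *m M = cols2 w' (- (rho z0 *m w')).
  by rewrite ME !mulmxA mulmxV // mul1mx PE mulmx_cols2 mulmxN w'E.
(* The first basis vector goes to minus the second, which gives the first column; determinant 1
   gives the upper right entry. *)
have [t Mt] : exists t, M = mat2 0 1 (-1) t.
  have e10 : cols2 w' (- (rho z0 *m w')) *m mat2 1 0 0 0 = P *m mat2 0 0 (-1) 0.
    rewrite PE !cols2_mulmx !scale0r !addr0 scale1r add0r.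
    by rewrite scaleN1r opprK.
  have : M *m mat2 1 0 0 0 = mat2 0 0 (-1) 0.
    by rewrite -[LHS](mulKmx Pu) (mulmxA P) M0 e10 mulKmx.
  rewrite [M]mat2_eta mulmx_mat2 !mulr0 !addr0 !mulr1 => /mat2_inj[e0 _ e1 _].
  exists (M 1 1); move: detM; rewrite {1}[M]mat2_eta det_mat2 e0 e1 mul0r add0r mulrN1 opprK.
  by move=> ->.
have [x x0 bx] := Ndiag b Nb.
(* [z0 b z0^-1] lies in [G'] too, so [M] conjugates [D(x)] into a diagonal [D(y)]. A nonzero [t]
   would then force [x = 1/x] and make [rho b] scalar. *)
have [y y0 cy] := Ndiag _ (derived_conj z0^-1%g Nb).
have MD : M *m diag2 x = diag2 y *m M.
  rewrite -bx -cy invgK !(proj2 rho_rep) repV ME -!mulmxA.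
  by rewrite !(mulKVmx Pu) (mulKmx (rep_unit z0)).
rewrite -ME Mt; congr mat2; apply/eqP/negPn/negP => t0.
move: MD; rewrite Mt /diag2 !mulmx_mat2 => /mat2_inj[_ _ e1 e2].
have xy : x = y^-1.
  by apply: oppr_inj; move: e1; rewrite !(mulr0, mul0r, addr0, add0r) mulN1r mulrN1.
have xV : x^-1 = x.
  by move: e2; rewrite !(mulr0, mul0r, add0r) -xy mulrC => /(mulIf t0).
have bE : rho b = P *m (invmx P *m rho b *m P) *m invmx P.
  by rewrite !mulmxA mulmxV // mul1mx mulmxK.
apply: (bN x); rewrite bE bx /diag2 xV -scalar_mat2.
by rewrite scalar_mxC -mulmxA mulmxV // mulmx1.
Qed.

End NormalForm.

Lemma SL2_rep_ext (R : realType) (G : groupType) (I : eqType) (y : I -> G) rels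
    (rho rho' : G -> 'M[R[i]]_2) : presents y rels ->
  SL2_representation rho -> SL2_representation rho' ->
  (forall i, rho (y i) = rho' (y i)) -> rho = rho'.
Proof.
move=> pres rep rep' e; apply/funext.
apply: (presents_ind pres) => // [a b ea eb|a ea|].
- by rewrite (proj2 rep) (proj2 rep') ea eb.
- by rewrite !repV ?ea.
- by rewrite !rep1.
Qed.

(** * The Fox matrix of a knot group *)

Section KnotGroupPresentation.
Variables (C : numClosedFieldType) (GK : groupType) (s : nat).
Variables (y : 'I_s.+1 -> GK) (rels : s.-tuple (word 'I_s.+1)) (ab : GK -> int).
Hypothesis presK : presents y rels.
Hypothesis abI : infinite_cyclic_abelianization ab.
Hypothesis ab_y0 : ab (y ord0) = 1.

Let deg i := ab (y i).

Definition fox_matrix_m1 : 'M[int]_s :=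
  \matrix_(j, i) fox_at_m1 (fun l => ab (y l)) (lift ord0 i) (tnth rels j).

(** [y_0] goes to [J = D(1) J], so the coordinate of the deleted column is 1. *)
Definition extend1 (u : {ffun 'I_s -> C}) (i : 'I_s.+1) : C :=
  if unlift ord0 i is Some j then u j else 1.

Lemma extend1_ord0 u : extend1 u ord0 = 1.
Proof. by rewrite /extend1 unlift_none. Qed.

Lemma extend1_lift u i : extend1 u (lift ord0 i) = u i.
Proof. by rewrite /extend1 liftK. Qed.

Lemma extend1_neq0 u : ffun_unit u -> forall i, extend1 u i != 0.
Proof.
by move=> /forallP u0 i; rewrite /extend1; case: unliftP => [j _|_]; rewrite ?oner_neq0.
Qed.

Lemma relator_deg r : r \in (rels : seq _) -> word_deg deg r = 0.
Proof.
move=> rR; have [abM _ _] := abI; rewrite /deg -(ab_word_eval abM).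
by rewrite (_ : word_eval y r = word_eval y [::]) ?ab1 //; apply/(proj2 presK)/WordRel.
Qed.

(** Relators have degree 0, so no power of [J] is left, and the [j]-th relator takes the value
    [D(x)] with [x] the [j]-th coordinate of [u^F]. *)
Lemma monomial_relators u (f : 'I_s.+1 -> SL2 C) : ffun_unit u ->
  (forall i, val (f i) = diag2 (extend1 u i) * rot2 C ^ deg i) ->
  (forall r, r \in (rels : seq _) -> word_eval f r = 1%g) <->
  mulact fox_matrix_m1 u = [ffun=> 1].
Proof.
move=> u0 fE; have e0 := extend1_neq0 u0.
have relE j : val (word_eval f (tnth rels j)) = diag2 (mulact fox_matrix_m1 u j).
  rewrite (word_eval_monomial e0 fE) relator_deg ?mem_tnth // expr0z mulr1.
  rewrite big_ord_recl extend1_ord0 exp1rz mul1r ffunE; congr diag2.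
  by apply: eq_bigr => i _; rewrite extend1_lift mxE.
split => [f1|uF r /tnthP[j ->]].
  apply/ffunP => j; rewrite [RHS]ffunE.
  have := relE j; rewrite f1 ?mem_tnth // -[val _]diag2_1 => /mat2_inj[-> //].
by apply: val_inj; rewrite relE uF ffunE diag2_1.
Qed.

Lemma monomial_lift u : ffun_unit u -> exists f : 'I_s.+1 -> SL2 C,
  forall i, val (f i) = diag2 (extend1 u i) * rot2 C ^ deg i.
Proof.
move=> /extend1_neq0 e0; have D1 i := det_diag2 (e0 i).
exists (fun i => toSL2 (D1 i) * gexpz (toSL2 (det_rot2 C)) (deg i))%g.
by move=> i; rewrite val_SL2M val_SL2_exp.
Qed.

Lemma derived_generator i : derived_subgroup (y i * (gexpz (y ord0) (deg i))^-1)%g.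
Proof.
have [abM _ abD] := abI; apply/abD.
by rewrite abM (abV abM) (ab_gexpz abM) ab_y0 mul1r subrr.
Qed.

(* Signs u give commuting matrices, so the morphism they define kills the
   derived subgroup and is determined by the value at y_0. *)
Lemma torus_kernel_sign (u : {ffun 'I_s -> C}) :
  torus_kernel fox_matrix_m1 u -> (forall i, u i ^+ 2 = 1) -> u = [ffun=> 1].
Proof.
move=> /andP[u0 /eqP uF] u2; have [f fE] := monomial_lift u0.
have [phi [phiM phiE]] := presents_morph presK (proj2 (monomial_relators u0 fE) uF).
have Ju := rot2_unit C.
(* For [x^2 = 1] the matrix [D(x)] is the scalar [x], so all images are multiples of powers of
   [J]. *)
have fZ i : val (f i) = extend1 u i *: rot2 C ^ deg i.
  rewrite fE -mul_scalar_mx scalar_mat2; congr (mat2 _ _ _ _ * _).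
  rewrite /extend1; case: unliftP => [j _|_]; last exact: invr1.
  by apply: (mulfI (forallP u0 j)); rewrite divff ?(forallP u0 j) // -expr2 u2.
have comm a b : commute (phi a) (phi b).
  have cM x : forall a b, commute x (phi a) -> commute x (phi b) -> commute x (phi (a * b)%g).
    by move=> ? ? ? ?; rewrite phiM; apply: commuteM.
  have cV x : forall a, commute x (phi a) -> commute x (phi a^-1%g).
    by move=> ? ?; rewrite gmorphV //; apply: commuteV.
  have c1 x : commute x (phi 1%g) by rewrite gmorph1 //; apply: commute1.
  apply: (presents_ind presK (cM _) (cV _) (c1 _)) => j; apply: commute_sym.
  apply: (presents_ind presK (cM _) (cV _) (c1 _)) => i; rewrite !phiE.
  apply: val_inj; rewrite !val_SL2M !fZ -!scalerAl -!scalerAr !scalerA -!exprzDr //.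
  by rewrite mulrC addrC.
apply/ffunP => i; rewrite [RHS]ffunE.
have := gmorph_derived_trivial phiM comm (derived_generator (lift ord0 i)).
rewrite phiM gmorphV // gmorph_gexpz // !phiE => /(congr1 val).
rewrite val_SL2M val_SL2V val_SL2_exp !fE extend1_ord0 extend1_lift diag2_1 mul1r /deg ab_y0.
rewrite expr1z mulrK ?unitrXz // => /(congr1 (fun M : 'M[C]_2 => M 0 0)).
by rewrite !mxE.
Qed.

(** If [det F] were even, a nonzero [v] in the kernel of [F] mod 2 would give signs [(-1)^v_i]
    forming a nontrivial solution of [u^F = 1], against [torus_kernel_sign]. *)
Lemma odd_det_fox_m1 : odd `|\det fox_matrix_m1|%N.
Proof.
apply/negPn/negP => det_even; pose A : 'M['F_2]_s := map_mx intr fox_matrix_m1.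
have ch2 : 2%N \in [pchar 'F_2] by rewrite pchar_Fp.
(* [det0P] yields a row vector acting from the left, hence the transpose. *)
have /det0P[v v0 vA] : \det A^T == 0.
  by rewrite det_tr det_map_mx -(dvdz_pcharf ch2) dvdzE /= dvdn2.
pose k i : nat := v 0 i; pose u : {ffun 'I_s -> C} := [ffun i => (-1) ^+ k i].
have u2 i : u i ^+ 2 = 1 by rewrite ffunE -exprM mulnC exprM sqrrN expr1n expr1n.
have uE i (n : int) : u i ^ n = (-1) ^+ (k i * `|n|)%N.
  rewrite ffunE exprM; case: n => l //=.
  by rewrite NegzE -exprz_inv -signr_odd invr_sign.
have absF2 (n : int) : (`|n|%N%:R : 'F_2) = n%:~R.
  case: n => l //; rewrite NegzE abszN /= mulrNz; apply/eqP.
  by rewrite -addr_eq0 -mulr2n mulrn_pchar.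
have ker : torus_kernel fox_matrix_m1 u.
  apply/andP; split; first by apply/forallP => i; rewrite ffunE signr_eq0.
  apply/eqP/ffunP => j; rewrite !ffunE.
  under eq_bigr do rewrite uE.
  rewrite prodrXr -signr_odd.
  rewrite (_ : odd _ = false) //; apply/negbTE; rewrite -dvdn2 (dvdn_pcharf ch2).
  have /matrixP/(_ 0 j) := vA; rewrite !mxE natr_sum => vAj; rewrite -[X in _ == X]vAj; apply/eqP.
  by apply: eq_bigr => i _; rewrite natrM absF2 !mxE natr_Zp.
have /ffunP u1 := torus_kernel_sign ker u2.
case/eqP: v0; apply/rowP => i; rewrite mxE.
have := u1 i; rewrite !ffunE -signr_odd; case k_odd: (odd _).
  by move/eqP; rewrite expr1 -subr_eq0 -opprD oppr_eq0 -(natrD _ 1 1) pnatr_eq0.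
by move=> _; rewrite -[LHS]natr_Zp; apply/eqP; rewrite -(dvdn_pcharf ch2) dvdn2 k_odd.
Qed.

End KnotGroupPresentation.

(** * Representations of the 2-knot group *)

Section TwistGroup.
Variables (R : realType) (GK G : groupType) (s : nat).
Variables (y : 'I_s.+1 -> GK) (rels : s.-tuple (word 'I_s.+1)) (ab : GK -> int).
Variables (m beta : int) (z : option 'I_s.+1 -> G).
Hypothesis presK : presents y rels.
Hypothesis abI : infinite_cyclic_abelianization ab.
Hypothesis ab_y0 : ab (y ord0) = 1.
Hypothesis presG : presents z (twist_relators rels m beta).
Hypothesis beta_odd : ~~ odd `|m|%N -> odd `|beta|%N.

Let C : numClosedFieldType := R[i].
Let z0 := z (Some ord0).
Let h := z None.
Let deg i := ab (y i).
Let F := fox_matrix_m1 y rels ab.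
(** The scalar [J^|m|] for even [m], which the power relator forces as the image of [h]. *)
Let eps : C := (-1) ^+ `|m|%N./2.

Lemma twist_relators_knot r : r \in (rels : seq _) -> word_eval (z \o Some) r = 1%g.
Proof.
move=> rR; rewrite -word_eval_map -[RHS]/(word_eval z [::]); apply/(proj2 presG)/WordRel.
by rewrite !mem_cat map_f.
Qed.

Lemma twist_relators_central i : (z (Some i) * h = h * z (Some i))%g.
Proof.
have : word_eval z [:: (Some i, true); (None, true); (Some i, false); (None, false)] = 1%g.
  rewrite -[RHS]/(word_eval z [::]); apply/(proj2 presG)/WordRel.
  rewrite !mem_cat; apply/orP; right; apply/orP; left.
  by apply/mapP; exists i; rewrite ?mem_enum.
rewrite /= mulg1 -/h => e; rewrite -[RHS]mul1g -e.
by rewrite !mulgA !mulgVK.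
Qed.

Lemma twist_relators_power : (gexpz z0 `|m|%N * gexpz h beta = 1)%g.
Proof.
rewrite -!word_eval_exp -word_eval_cat -[RHS]/(word_eval z [::]).
by apply/(proj2 presG)/WordRel; rewrite !mem_cat inE eqxx !orbT.
Qed.

Lemma twist_central a : (h * a = a * h)%g.
Proof.
apply: (presents_ind presG (P := commute h)).
- by move=> *; apply: commuteM.
- by move=> *; apply: commuteV.
- exact: commute1.
- by case=> [i|] //; apply: commute_sym; apply: twist_relators_central.
Qed.

(** Carries elements of the derived subgroup, recognized in the knot group by their degree, over to
    [G]. *)
Lemma twist_knot_morph : exists psi : GK -> G,
  (forall a b, psi (a * b) = psi a * psi b)%g /\ (forall i, psi (y i) = z (Some i)).
Proof. exact: (presents_morph presK twist_relators_knot). Qed.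

Lemma twist_derived_generator i :
  derived_subgroup (z (Some i) * (gexpz z0 (deg i))^-1)%g.
Proof.
have [psi [psiM psiE]] := twist_knot_morph.
have := gmorph_derived psiM (derived_generator abI ab_y0 i).
by rewrite psiM gmorphV // gmorph_gexpz // !psiE.
Qed.

Lemma twist_generation (P : G -> Prop) :
  (forall a b, P a -> P b -> P (a * b)%g) -> (forall a, P a -> P (a^-1)%g) -> P 1%g ->
  (forall a, derived_subgroup a -> P a) -> P z0 -> P h -> forall a, P a.
Proof.
move=> PM PV P1 PN Pz Ph; apply: (presents_ind presG) => // -[i|] //.
rewrite -[z (Some i)](mulgVK (gexpz z0 (deg i))); apply: (PM).
  exact/PN/twist_derived_generator.
exact: (gexpz_closed _ PM PV P1 Pz).
Qed.

(** A relation and not a function of [u], because such a representation exists only under conditions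
    on [m] and [u]. *)
Definition standard_rep (u : {ffun 'I_s -> C}) (rho : G -> 'M[R[i]]_2) :=
  [/\ SL2_representation rho,
      forall i, rho (z (Some i)) = diag2 (extend1 u i) * rot2 _ ^ deg i
    & rho h = eps%:M].

Lemma standard_rep_uniq u rho rho' : standard_rep u rho -> standard_rep u rho' -> rho = rho'.
Proof.
move=> [r e eh] [r' e' eh']; apply: (SL2_rep_ext presG) => // -[i|].
  by rewrite e e'.
by rewrite eh eh'.
Qed.

Lemma standard_rep_z0 u rho : standard_rep u rho -> rho z0 = rot2 _.
Proof. by move=> [_ e _]; rewrite e extend1_ord0 /deg ab_y0 expr1z diag2_1 mul1r. Qed.

Lemma standard_rep_derived u rho i : standard_rep u rho ->
  rho (z (Some i) * (gexpz z0 (deg i))^-1)%g = diag2 (extend1 u i).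
Proof.
move=> st; have [r e _] := st; rewrite (proj2 r) repV // rep_gexpz // (standard_rep_z0 st) e.
by apply: (mulrK (unitrXz _ (rot2_unit C))).
Qed.

Lemma standard_rep_exists u : ~~ odd `|m|%N -> torus_kernel F u ->
  exists rho, standard_rep u rho.
Proof.
move=> m_even /andP[u0 /eqP uF]; have [f fE] := monomial_lift y ab u0.
have f1 := proj2 (monomial_relators presK abI u0 fE) uF.
have dE : \det (eps%:M : 'M[C]_2) = 1 by rewrite det_scalar -exprM mulnC exprM sqrrN expr1n expr1n.
pose E : SL2 C := toSL2 dE.
have EE : (E * E = 1)%g.
  by apply: val_inj; rewrite val_SL2M /= -[_ * _]scalar_mxM -expr2 -det_scalar dE.
pose g (i : option 'I_s.+1) := if i is Some j then f j else E.
have g1 r : r \in twist_relators rels m beta -> word_eval g r = 1%g.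
  rewrite !mem_cat inE => /orP[/mapP[w wR ->]|/orP[/mapP[i _ ->]|/eqP->]].
  - by rewrite word_eval_map f1.
  - have EC : (f i * E = E * f i)%g by apply: val_inj; rewrite !val_SL2M; apply: scalar_mxC.
    by rewrite /= mulg1 mulgA EC -mulgA mulVKg mulgV.
  (* As [E^2 = 1] and [beta] is odd, the power relator reduces to [J^|m| = E]. *)
  - rewrite word_eval_cat !word_eval_exp /= (gexpz_involution _ EE) beta_odd // -EE.
    congr (_ * _)%g; apply: val_inj.
    rewrite -[(_ ^+ _)%g]/(gexpz (f ord0) `|m|%N) val_SL2_exp fE extend1_ord0.
    rewrite ab_y0 expr1z diag2_1 mul1r.
    exact: rot2_even.
have [phi [phiM phiE]] := presents_morph presG g1.
exists (val \o phi); split => [|i|]; last by rewrite /= phiE.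
  by split => [a|a b] /=; rewrite ?SL2_det // phiM.
by rewrite /= phiE fE.
Qed.

(** All values are monomial matrices [D(x) J^k]; the degrees cancel in commutators, so [G'] lands in
    the diagonal matrices. *)
Lemma standard_rep_metabelian u rho : ffun_unit u -> standard_rep u rho -> metabelian rho.
Proof.
move=> u0 st; have [r e eh] := st.
have mono a : exists k, monomial2 (rho a) k.
  apply: (presents_ind presG (P := fun a => exists k, monomial2 (rho a) k)) => [{}a b|{}a||i].
  - by move=> [k ak] [l bl]; exists (k + l); rewrite (proj2 r); apply: monomial2M.
  - by move=> [k ak]; exists (- k); rewrite repV //; apply: monomial2V.
  - by exists 0, 1; rewrite ?oner_neq0 // rep1 // diag2_1 mul1r.
  - case: i => [i|].
      by exists (deg i), (extend1 u i); rewrite ?extend1_neq0.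
    (* [eps] is its own inverse, so the scalar matrix [eps] is [D(eps)]. *)
    exists 0, eps; rewrite ?signr_eq0 // eh expr0z mulr1 scalar_mat2 /diag2 /eps.
    by rewrite -signr_odd invr_sign.
have diag a : derived_subgroup a -> monomial2 (rho a) 0.
  elim=> {a} [a b||a b _ IHa _ IHb|a _ IHa].
  - have [k ak] := mono a; have [l bl] := mono b.
    have -> : 0 = - k + (- l + (k + l)) by ring.
    rewrite !(proj2 r) !repV //; apply: monomial2M; first exact: monomial2V.
    by apply: monomial2M; [exact: monomial2V|exact: monomial2M].
  - by exists 1; rewrite ?oner_neq0 // rep1 // diag2_1 mul1r.
  - by rewrite -[0]addr0 (proj2 r); apply: monomial2M.
  - by rewrite -[0]oppr0 repV //; apply: monomial2V.
move=> a b /diag[x x0 ->] /diag[x' x'0 ->]; rewrite expr0z !mulr1.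
by rewrite -[LHS]diag2M -[RHS]diag2M mulrC.
Qed.

(** An eigenvector of [J] has both coordinates nonzero; if it is also one of [D(u_i)], then
    [u_i = 1/u_i], and [torus_kernel_sign] gives [u = 1]. *)
Lemma standard_rep_irreducible u rho :
  torus_kernel F u -> u != [ffun=> 1] -> standard_rep u rho -> irreducible rho.
Proof.
move=> ker u1 st [v v0 stab]; have [r _ _] := st; case/eqP: u1.
apply: (torus_kernel_sign presK abI ab_y0 ker) => i.
have [c] := stab (z (Some (lift ord0 i)) * (gexpz z0 (deg (lift ord0 i)))^-1)%g.
rewrite (standard_rep_derived _ st) extend1_lift => Dv.
have [d] := stab z0; rewrite (standard_rep_z0 st) => Jv.
have /matrixP/(_ 0 0) := Dv; have /matrixP/(_ 1 0) := Dv.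
have /matrixP/(_ 0 0) := Jv; have /matrixP/(_ 1 0) := Jv.
rewrite !mulmx_entry2 !mxE /= !mul0r !add0r !addr0 mul1r mulN1r => J1 J0 D1 D0.
have v00 : v 0 0 != 0.
  apply/negP => /eqP v00; case/eqP: v0; apply: col2P; rewrite mxE // J0 v00 mulr0 //.
have v10 : v 1 0 != 0.
  by apply: contraNneq v00 => v10; rewrite -oppr_eq0 J1 v10 mulr0.
have ui0 : u i != 0 by case/andP: ker => /forallP.
by rewrite expr2 {1}(mulIf v00 D0) -(mulIf v10 D1) mulVf.
Qed.

(** Conjugation by [J] inverts [D(x)] and fixes the powers of [J]. *)
Lemma standard_rep_inv u rho rho' : ffun_unit u ->
  standard_rep u rho -> standard_rep (ffun_inv u) rho' -> SL2_conjugate rho rho'.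
Proof.
move=> u0 st st'; have [r e eh] := st; have [r' e' eh'] := st'.
pose rho1 a := rot2 C *m rho a *m invmx (rot2 C).
have cj : SL2_conjugate rho rho1 by exists (rot2 C); rewrite ?det_rot2.
suff <- : rho1 = rho' by [].
apply: (standard_rep_uniq _ st'); split; first exact: SL2_conjugate_rep r.
  move=> i; rewrite /rho1 e.
  apply: (mulIr (rot2_unit C)); rewrite -[LHS]/(rot2 C *m _ *m _ *m rot2 C).
  rewrite mulmxKV; last exact: rot2_unit.
  rewrite [LHS]mulrA rot2_diag2 -!mulrA.
  have -> : rot2 C * rot2 C ^ deg i = rot2 C ^ deg i * rot2 C.
    transitivity (rot2 C ^ (1 + deg i)); first by rewrite exprzDr ?rot2_unit // expr1z.
    by rewrite addrC exprzDr ?rot2_unit // expr1z.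
  congr (diag2 _ * _).
  by rewrite /extend1; case: unliftP => [j _|_]; rewrite ?ffunE ?invr1.
by rewrite /rho1 eh scalar_mxC -mulmxA mulmxV ?mulmx1 //; exact: rot2_unit.
Qed.

(** A conjugating [P] commutes with [J], hence is [[[a, b], [-b, a]]]; intertwining [D(u_j)] with
    [D(v_j)] then yields [v = u] if [a != 0] and [v = 1/u] if [b != 0]. *)
Lemma standard_rep_conj u v rho rho' : torus_kernel F u -> torus_kernel F v ->
  standard_rep u rho -> standard_rep v rho' -> SL2_conjugate rho rho' ->
  v = u \/ v = ffun_inv u.
Proof.
move=> /andP[/forallP u0 _] /andP[/forallP v0 _] st st' [P dP e].
have PE a : P *m rho a = rho' a *m P by rewrite e mulmxKV ?det1_unit.
have PJ := PE z0; rewrite (standard_rep_z0 st) (standard_rep_z0 st') in PJ.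
have PD j : P *m diag2 (u j) = diag2 (v j) *m P.
  have := PE (z (Some (lift ord0 j)) * (gexpz z0 (deg (lift ord0 j)))^-1)%g.
  by rewrite (standard_rep_derived _ st) (standard_rep_derived _ st') !extend1_lift.
pose a := P 0 0; pose b := P 0 1; have PE2 : P = mat2 a b (- b) a.
  move: PJ; rewrite [P]mat2_eta !mulmx_mat2 !(mul0r, mulr0, add0r, addr0) !mulr1 mulrN1 !mul1r.
  by move=> /mat2_inj[<- <-].
have av j : a * u j = v j * a /\ b * (u j)^-1 = v j * b.
  move: (PD j); rewrite PE2 !mulmx_mat2 !(mul0r, mulr0, add0r, addr0).
  by move=> /mat2_inj[-> -> _ _].
have [a0|a0] := eqVneq a 0; [right|left]; apply/ffunP => j; have [e1 e2] := av j.
  have b0 : b != 0.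
    apply: contra_eq_neq dP => b0; rewrite PE2 a0 b0 det_mat2 !mul0r subr0 eq_sym.
    exact: oner_neq0.
  by rewrite ffunE; apply: (mulIf b0); rewrite -e2 mulrC.
by apply: (mulIf a0); rewrite -e1 mulrC.
Qed.

(** The diagonal images of [z_i z_0^-d_i] define [u]; the knot relators give [u^F = 1], and the
    power relator gives the parity of [m] and the image of [h]. *)
Lemma twist_normal_form rho :
  SL2_representation rho -> metabelian rho -> irreducible rho ->
  ~~ odd `|m|%N /\
  exists u, [/\ torus_kernel F u, u != [ffun=> 1]
    & exists2 rho', standard_rep u rho' & SL2_conjugate rho rho'].
Proof.
move=> r mt irr.
have [P [dP PN PJ]] := normal_form r irr twist_central twist_generation mt.
have [e e2 he] := rep_central r irr twist_central.
have Pu := det1_unit dP.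
pose rho' a := invmx P *m rho a *m P.
have cj : SL2_conjugate rho rho'.
  by exists (invmx P) => [|a]; rewrite ?det_inv ?dP ?invr1 // invmxK.
have r' := SL2_conjugate_rep cj r.
have he' : rho' h = e%:M by rewrite /rho' he scalar_mxC -mulmxA mulVmx // mulmx1.
have {}PJ : rho' z0 = rot2 C by [].
have {}PN a : derived_subgroup a -> exists2 x, x != 0 & rho' a = diag2 x by apply: PN.
clearbody rho'.
have [x xE] : exists x : {ffun 'I_s.+1 -> C}, forall i, x i != 0 /\
    rho' (z (Some i) * (gexpz z0 (deg i))^-1)%g = diag2 (x i).
  have [f f0 fE] := fin_all_exists2 (fun i => PN _ (twist_derived_generator i)).
  by exists (finfun f) => i; rewrite ffunE; split; [exact: f0|exact: fE].
pose u : {ffun 'I_s -> C} := [ffun j => x (lift ord0 j)].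
have u0 : ffun_unit u by apply/forallP => j; rewrite ffunE; case: (xE (lift ord0 j)).
have r'E i : rho' (z (Some i)) = diag2 (extend1 u i) * rot2 C ^ deg i.
  rewrite /extend1; case: unliftP => [j ->|->].
    have [_] := xE (lift ord0 j); rewrite ffunE (proj2 r') repV // => <-.
    by rewrite (rep_gexpz r') PJ -[RHS]mulmxA mulVmx ?mulmx1 //; apply: unitrXz (rot2_unit C).
  by rewrite /deg ab_y0 expr1z diag2_1 mul1r.
have [phi [phiM phiE]] := rep_lift r'.
have uF : mulact F u = [ffun=> 1].
  apply: (proj1 (monomial_relators presK abI (f := phi \o (z \o Some)) u0 _)).
    by move=> i; rewrite /= phiE r'E.
  by move=> w wR; rewrite -gmorph_word_eval // twist_relators_knot // gmorph1.
have ker : torus_kernel F u by rewrite /torus_kernel u0 uF eqxx.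
have hh : (phi h * phi h = 1)%g.
  by apply: val_inj; rewrite val_SL2M phiE he' -[LHS]scalar_mxM -expr2 e2.
have pow : (gexpz (phi z0) `|m|%N * gexpz (phi h) beta = 1)%g.
  by rewrite -!gmorph_gexpz // -phiM twist_relators_power gmorph1.
(* The image of [h] has square 1, so its power is its own inverse. *)
have JX : gexpz (phi z0) `|m|%N = gexpz (phi h) beta.
  apply: (mulIg (gexpz (phi h) beta)); rewrite pow gexpz_involution //.
  by case: odd; rewrite ?hh ?mulg1.
have {}JX : rot2 C ^+ `|m|%N = val (gexpz (phi h) beta).
  by rewrite -JX val_SL2_exp phiE PJ.
(* An odd power of [J] is not scalar, while every power of the image of [h] is. *)
have m_even : ~~ odd `|m|%N.
  apply/negP => m_odd; move: JX; rewrite gexpz_involution //.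
  case: odd; first by rewrite phiE he'; apply: rot2_odd_not_scalar.
  exact: (rot2_odd_not_scalar (c := 1)).
split => //; exists u; split => //; last first.
  exists rho' => //; split => //; rewrite he'.
  by move: JX; rewrite gexpz_involution // beta_odd // phiE he' rot2_even.
(* For [u = 1] all generators act by powers of [J] or by scalars, so an eigenvector of [J] spans an
   invariant line. *)
apply/eqP => u1; apply: (SL2_conjugate_irreducible cj irr).
have [v v0 [c Jv]] := eigenvector2 (rot2 C); exists v => //.
have z0v : stable_line rho' v z0 by exists c; rewrite -Jv; congr (_ *m _).
have lM a b : stable_line rho' v a -> stable_line rho' v b -> stable_line rho' v (a * b)%g.
  exact: stable_lineM.
have lV a : stable_line rho' v a -> stable_line rho' v (a^-1)%g by apply: stable_lineV.
have l1 : stable_line rho' v 1%g by apply: stable_line1.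
apply: (presents_ind presG lM lV l1) => -[i|]; last first.
  by exists e; rewrite -mul_scalar_mx -he'.
have := gexpz_closed (deg i) lM lV l1 z0v; rewrite /stable_line (rep_gexpz r') PJ r'E.
suff -> : extend1 u i = 1 by rewrite diag2_1 mul1r.
by rewrite u1 /extend1; case: unliftP => [j _|//]; rewrite ffunE.
Qed.

(** * Counting the conjugacy classes *)

Lemma metabelian_classes_odd : odd `|m|%N -> @irreducible_metabelian_classes R G = set0.
Proof.
move=> m_odd; apply/seteqP; split => // c [rho [r mt irr] _].
by have [] := twist_normal_form r mt irr; rewrite m_odd.
Qed.

Lemma metabelian_classes_even : ~~ odd `|m|%N ->
  exists2 c : nat, (@irreducible_metabelian_classes R G #= `I_c)%card
    & (c.*2.+1 = `|\det F|)%N.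
Proof.
move=> m_even.
have F_odd : odd `|\det F|%N := odd_det_fox_m1 C presK abI ab_y0.
have F0 : \det F != 0 by apply: contraTneq F_odd => ->.
have [S [uS szS memS]] := torus_kernel_seq C F0.
have one_S : [ffun=> 1] \in S by rewrite memS torus_kernel_one.
have S1 u : u \in rem [ffun=> 1] S = (u != [ffun=> 1]) && torus_kernel F u.
  by rewrite mem_rem_uniq // inE memS.
(* Inversion acts freely once [u = 1] is removed, since a fixed point consists of signs; [H] keeps
   one of each pair [u], [1/u]. *)
have [u|u|H [uH szH sH HP HN]] := involution_half (rem_uniq [ffun=> 1] uS) (@ffun_invK C s).
- rewrite !S1 => /andP[u1 ker]; rewrite torus_kernel_inv // andbT.
  apply: contraNneq u1 => e; rewrite -(ffun_invK u) e.
  by apply/eqP/ffunP => i; rewrite !ffunE invr1.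
- rewrite S1 => /andP[u1 ker]; apply: contraNneq u1 => /ffunP e; apply/eqP.
  apply: (torus_kernel_sign presK abI ab_y0 ker) => i.
  have /andP[/forallP u0 _] := ker; rewrite expr2 -{1}e ffunE mulVf //.
exists (size H); last by rewrite szH size_rem // szS prednK // lt0n absz_eq0.
(* A total choice of representations; outside the kernel the zero function is a default value. *)
have [u|rep repP] := @choice {ffun 'I_s -> C} (G -> 'M[R[i]]_2)
    (fun u rho => torus_kernel F u -> standard_rep u rho).
  have [ker|nker] := boolP (torus_kernel F u).
    by have [rho st] := standard_rep_exists m_even ker; exists rho.
  by exists (fun _ => 0).
pose uk k := nth [ffun=> 1] H k; pose cl k := [set r | SL2_conjugate (rep (uk k)) r]%classic.
have kerH k : (k < size H)%N -> torus_kernel F (uk k) /\ uk k != [ffun=> 1].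
  by move=> ltk; have := sH _ (mem_nth [ffun=> 1] ltk); rewrite S1 => /andP[].
have -> : @irreducible_metabelian_classes R G = (cl @` `I_(size H))%classic.
  apply/seteqP; split => c /=.
    move=> [rho [r mt irr] ->].
    have [_ [u [ker u1 [rho' st cj]]]] := twist_normal_form r mt irr.
    have [k ltk cjk] : exists2 k, (k < size H)%N & SL2_conjugate (rep (uk k)) rho.
      have [|uH'|uH'] := HP u; first by rewrite S1 u1.
        exists (index u H); rewrite ?index_mem // /uk nth_index //.
        by rewrite (standard_rep_uniq (repP u ker) st); apply: SL2_conjugate_sym.
      exists (index (ffun_inv u) H); rewrite ?index_mem // /uk nth_index //.
      apply: SL2_conjugate_sym; apply: (SL2_conjugate_trans cj).
      apply: (standard_rep_inv _ st); first by case/andP: ker.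
      exact/repP/torus_kernel_inv.
    by exists k => //; apply: SL2_conjugate_class.
  move=> [k ltk <-]; have [ker u1] := kerH k ltk; have st := repP _ ker.
  exists (rep (uk k)) => //; split; first by case: st.
    by apply: (standard_rep_metabelian _ st); case/andP: ker.
  exact: (standard_rep_irreducible ker u1 st).
apply: inj_card_eq => k l; rewrite !inE /= => ltk ltl cl_eq.
have [kerk k1] := kerH k ltk; have [kerl l1] := kerH l ltl.
have cj : SL2_conjugate (rep (uk k)) (rep (uk l)).
  have : cl l (rep (uk l)).
    by exists 1%:M => [|a]; rewrite ?det1 // invmx1 mulmx1 mul1mx.
  by rewrite -cl_eq.
(* Either the parameters agree and so do their indices in [H], or they are inverse to each other,
   which [H] excludes. *)
have [e|e] := standard_rep_conj kerk kerl (repP _ kerk) (repP _ kerl) cj.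
  by apply/eqP; rewrite -(nth_uniq [ffun=> 1] ltk ltl uH); apply/eqP.
by have := HN _ (mem_nth [ffun=> 1] ltk); rewrite -/(uk k) -e mem_nth.
Qed.
End TwistGroup.

(** * The choice of beta, the value of the Alexander polynomial at -1, and the final count *)

Lemma twist_exponent_exists (m : int) (n : nat) :
  [/\ m <> 0, (0 < n)%N & coprime `|m|%N n] \/ m = 0 /\ n = 1%N ->
  exists2 beta, twist_exponent m n beta & ~~ odd `|m|%N -> odd `|beta|%N.
Proof.
case=> [[/eqP m0 _ co]|[-> ->]]; last by exists 1; rewrite /twist_exponent ?eqxx.
have [a [b ab1]] := Bezoutz m n; rewrite /gcdz absz_nat (eqP co) in ab1.
pose e : int := if 0 <= m then 1 else -1.
(* [b] inverts [n] modulo [m], and [e] is the prescribed sign. *)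
exists (e * b).
  rewrite /twist_exponent (negPf m0) -/e; apply/eqP; rewrite eqz_mod_dvd.
  apply/dvdzP; exists (- e * a).
  have -> : n%:Z * (e * b) - e = e * ((a * m + b * n) - a * m - 1) by ring.
  by rewrite ab1; ring.
(* For even [m], an even [b] would make [a m + b n = 1] even. *)
move=> m_even; apply: contraT; rewrite abszM (_ : `|e|%N = 1%N); last by rewrite /e; case: ifP.
rewrite mul1n => b_even.
have : (2 %| a * m + b * n)%Z.
  by apply: rpredD; [apply: dvdz_mull|apply: dvdz_mulr]; rewrite dvdzE /= dvdn2.
by rewrite ab1.
Qed.

(** The unit relating [Delta] to the determinant takes the value 1 or -1 at [t = -1], and the
    absolute value absorbs it. *)
Lemma alexander_polynomial_at_m1 (GK : groupType) (s : nat) (y : 'I_s.+1 -> GK)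
    (rels : s.-tuple (word 'I_s.+1)) (ab : GK -> int) (sgn : bool) (k : int) Delta :
  tofrac Delta = (-1) ^+ sgn * tvar ^ k *
    \det (\matrix_(j < s, i < s) fox (fun l => ab (y l)) (lift ord0 i) (tnth rels j)) ->
  `|Delta.[-1]| = `|\det (fox_matrix_m1 y rels ab)|.
Proof.
move=> dE; set F := fox_matrix_m1 y rels ab.
have -> : Delta.[-1] = (-1) ^+ sgn * zsign k * \det F.
  apply: value_at_m1_inj; rewrite dE; apply: value_at_m1M.
    apply: value_at_m1M; last exact: value_at_m1_tvar.
    by have := value_at_m1_int ((-1) ^+ sgn); rewrite rmorph_sign.
  by apply: value_at_m1_det => j i; rewrite !mxE; apply: value_at_m1_fox.
by rewrite !normrM normr_zsign normrX normrN1 expr1n !mul1r.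
Qed.

Theorem theorem1p1 (R : realType) (K : 'rV[R]_2 -> 'rV[R]_4) (m : int) (n : nat)
    (B N : set 'rV[R]_5) (x0 : 'rV[R]_5) (G : groupType)
    (cls : (R -> 'rV[R]_5) -> G) (Delta : {poly int})
    (hK : knot K)
    (hmn : [/\ m <> 0, (0 < n)%N & coprime `|m|%N n] \/ m = 0 /\ n = 1%N)
    (hB : branched_twist_spin K m n B)
    (hN : tubular_neighborhood B N)
    (hG : is_pi1 (exterior N) x0 cls)
    (hDelta : alexander_polynomial K Delta)
    (hdesc : known_group_description K m n G) :
  exists c : nat,
    (@irreducible_metabelian_classes R G #= `I_c)%card /\
    c%:R = (if odd `|m|%N then 0 else (`|Delta.[-1]|%:~R - 1) / 2) :> rat.
Proof.
have [x1 [GK [cls1 [s [y [rels [ab [sgn [k [pi1 presK mer [abI ab_y0] dE]]]]]]]]]] := hDelta.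
have [beta tw beta_odd] := twist_exponent_exists hmn.
(* The group description is applied to the presentation that computes [Delta], so that one Fox
   matrix serves both. *)
have [z presG] := hdesc _ _ _ _ _ _ _ pi1 presK mer tw.
case: (boolP (odd `|m|%N)) => m_par.
  exists 0%N; split => //.
  by rewrite (metabelian_classes_odd R presK abI ab_y0 presG) // II0 card_eq00.
have [c card_c cE] := metabelian_classes_even R presK abI ab_y0 presG beta_odd m_par.
(* Here [|Delta(-1)| = 2c + 1]. *)
exists c; split => //; rewrite (alexander_polynomial_at_m1 dE) -abszE -cE.
rewrite -[_%:~R]/(c.*2.+1%:R : rat) -natr1 addrK -muln2 natrM mulfK //.
Qed.
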